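(* Let $G$ be a solvable group with a finite sequence of normal subgroups $G=U_1\supseteq U_2\supseteq\dots\supseteq U_s=1$ such that the quotients $U_i/U_{i+1}$ are abelian and the $\mathbb Q$-vector spaces $U_i/U_{i+1}\otimes\mathbb Q$ are finite dimensional. Then $G$ is $\mathbb Q$-prenilpotent. In particular, $\hat G_{\mathbb Q}$ is cohomologically discrete over $\mathbb Q$. Moreover, if $G$ is finitely generated, then it is $H\mathbb Q$-good.
   Context: The lower $\mathbb Q$-central series is $\gamma_1^{\mathbb Q}G=G$, $\gamma_{i+1}^{\mathbb Q}G=\mathrm{Ker}(\gamma_i^{\mathbb Q}G\to \gamma_i^{\mathbb Q}G/[\gamma_i^{\mathbb Q}G,G]\otimes \mathbb Q)$. $G$ is $\mathbb Q$-prenilpotent if $\gamma_i^{\mathbb Q}G=\gamma_{i+1}^{\mathbb Q}G$ for big enough $i$. The $\mathbb Q$-completion is $\hat G_{\mathbb Q}=\varprojlim (G/\gamma_i^{\mathbb Q}G\otimes\mathbb Q)$, where $-\otimes\mathbb Q$ is the Malcev completion (rationalization) of a nilpotent group; it is a topological group with the topology of an inverse limit of discrete groups. Uniform cohomology: for a topological group $\mathscr G$ whose left and right uniform structures coincide and a topological $\mathscr G$-module $\mathscr M$, $H^n_u(\mathscr G,\mathscr M)$ is the cohomology of the complex of uniformly continuous cochains $f:\mathscr G^n\to\mathscr M$ with the usual inhomogeneous group cohomology differential. $\mathscr G$ is cohomologically discrete over $\mathbb Q$ if the obvious map $H^m_u(\mathscr G,\mathbb Q)\to H^m(\mathscr G,\mathbb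 Q)$ is an isomorphism for all $m$, where $\mathbb Q$ is the discrete trivial module and the right-hand side is cohomology of the underlying abstract group. $H\mathbb Q$-goodness: Bousfield's $H\mathbb Q$-localization of $G$ is a homomorphism $G\to G_{H\mathbb Q}$ that induces an isomorphism on $H_1(-,\mathbb Q)$ and an epimorphism on $H_2(-,\mathbb Q)$ and is universal among homomorphisms out of $G$ with these two properties. There is a natural homomorphism $G_{H\mathbb Q}\to\hat G_{\mathbb Q}$; $G$ is $H\mathbb Q$-good if it is an isomorphism. It is known (Bousfield) that $G$ is $H\mathbb Q$-good if and only if $H_1(G,\mathbb Q)\to H_1(\hat G_{\mathbb Q},\mathbb Q)$ is an isomorphism and $H_2(G,\mathbb Q)\to H_2(\hat G_{\mathbb Q},\mathbb Q)$ is an epimorphism, and that the condition on $H_1$ is automatic for finitely generated $G$. *)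

(* Defs.v *)
From HB Require Import structures.
From mathcomp Require Import all_boot all_order all_algebra.
From mathcomp Require Import all_classical topology.
From mathcomp Require Import freeg.

Set Implicit Arguments.
Unset Strict Implicit.
Unset Printing Implicit Defensive.

Import GRing.Theory.
Local Open Scope group_scope.
Local Open Scope quotient_scope.
Local Open Scope classical_set_scope.

Record nsgroup (G : groupType) := NSGroup {
  nspred :> {pred G};
  ns_closed : group_closed nspred;
  ns_conj : forall x g, x \in nspred -> x ^ g \in nspred }.

HB.instance Definition _ G (N : nsgroup G) :=
  isMulClosed.Build G (nspred N) (group_closedM (ns_closed N)).
HB.instance Definition _ G (N : nsgroup G) :=
  isMul1Closed.Build G (nspred N) (ns_closed N).1.
HB.instance Definition _ G (N : nsgroup G) :=
  isInvClosed.Build G (nspred N) (group_closedV (ns_closed N)).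

Section Subgroup.
Variables (G : groupType) (N : nsgroup G).

Record subg_of := Subg { subg_val :> G; subg_valP : subg_val \in N }.
HB.instance Definition _ := [isSub of subg_of for subg_val].
HB.instance Definition _ := [Choice of subg_of by <:].
HB.instance Definition _ :=
  SubChoice_isSubGroup.Build G (nspred N) subg_of (ns_closed N).
End Subgroup.

Section Quotient.
Variables (G : groupType) (N : nsgroup G).

Definition coset_eq (x y : G) : bool := x^-1 * y \in N.

Lemma coset_eq_equiv : equiv_class_of coset_eq.
Proof.
split=> [x|x y|y x z]; rewrite /coset_eq.
- by rewrite mulVg gpred1.
- by rewrite -[in RHS]gpredV invgM invgK.
- by move=> Nxy Nyz; rewrite -[z](mulVKg y) mulgA gpredM.
Qed.

Canonical coset_eq_equivRel := EquivRelPack coset_eq_equiv.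
Definition quotg := {eq_quot coset_eq}.
HB.instance Definition _ := Choice.on quotg.
HB.instance Definition _ := EqQuotient.on quotg.

Definition pig (x : G) : quotg := \pi_quotg x.

Lemma pigP x y : (pig x = pig y) <-> (x^-1 * y \in N).
Proof. by split=> [/eqmodP//|h]; apply/eqmodP. Qed.

Lemma pigK (a : quotg) : pig (repr a) = a. Proof. exact: reprK. Qed.

Definition mulq (a b : quotg) : quotg := pig (repr a * repr b).
Definition invq (a : quotg) : quotg := pig (repr a)^-1.

Lemma mulqE x y : mulq (pig x) (pig y) = pig (x * y).
Proof.
have /pigP Nx := pigK (pig x); have /pigP Ny := pigK (pig y).
apply/pigP; rewrite invgM.
set a := repr (pig x) in Nx *; set b := repr (pig y) in Ny *.
have -> : b^-1 * a^-1 * (x * y) = ((a^-1 * x) ^ b) * (b^-1 * y).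
  by rewrite conjgE !mulgA mulgK.
by rewrite gpredM // ns_conj.
Qed.

Lemma invqE x : invq (pig x) = pig x^-1.
Proof.
have /pigP Nx := pigK (pig x); apply/pigP; rewrite invgK.
set a := repr _ in Nx *.
have -> : a * x^-1 = ((a^-1 * x)^-1) ^ a^-1.
  by rewrite conjgE invgM !invgK !mulgA mulgK.
by rewrite ns_conj // gpredV.
Qed.

Lemma mulqA : associative mulq.
Proof.
by move=> a b c; rewrite -(pigK a) -(pigK b) -(pigK c) !mulqE mulgA.
Qed.
Lemma mul1q : left_id (pig 1) mulq.
Proof. by move=> a; rewrite -(pigK a) mulqE mul1g. Qed.
Lemma mulq1 : right_id (pig 1) mulq.
Proof. by move=> a; rewrite -(pigK a) mulqE mulg1. Qed.
Lemma mulVq : left_inverse (pig 1) invq mulq.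
Proof. by move=> a; rewrite -(pigK a) invqE mulqE mulVg. Qed.
Lemma mulqV : right_inverse (pig 1) invq mulq.
Proof. by move=> a; rewrite -(pigK a) invqE mulqE mulgV. Qed.

HB.instance Definition _ :=
  isGroup.Build quotg mulqA mul1q mulq1 mulVq mulqV.

Lemma pigM : {morph pig : x y / x * y}.
Proof. by move=> x y; exact: esym (mulqE x y). Qed.
HB.instance Definition _ := isMultiplicative.Build G quotg pig pigM.
End Quotient.

Section Section.
Variables (G : groupType) (H N : nsgroup G).

Definition sect_pred : {pred subg_of H} := [pred x | subg_val x \in N].

Lemma sect_closed : group_closed sect_pred.
Proof.
split=> [|x y]; rewrite !inE /= ?gpred1 // => Nx Ny.
exact: gpredF.
Qed.

Lemma sect_conj x g : x \in sect_pred -> x ^ g \in sect_pred.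
Proof. by rewrite !inE => /ns_conj; exact. Qed.

Definition sectns : nsgroup (subg_of H) := NSGroup sect_closed sect_conj.

(* H / (H /\ N), which is H / N when N is contained in H *)
Definition sect := quotg sectns.
HB.instance Definition _ := Group.on sect.
End Section.

Section Span.
Variables (V : lmodType rat) (S : set V).
Local Open Scope ring_scope.

Definition span : {pred V} := fun x =>
  `[< exists n (c : 'I_n -> rat) (v : 'I_n -> V),
        (forall i, S (v i)) /\ x = \sum_i c i *: v i >].

Lemma span_submod_closed : GRing.submod_closed span.
Proof.
split=> [|a x y]; rewrite !unfold_in.
  by apply/asboolP; exists 0%N, (fun=> 0), (fun=> 0); split=> [[]//|]; rewrite big_ord0.
move=> /asboolP[n [c [v [Sv ->]]]] /asboolP[m [d [w [Sw ->]]]]; apply/asboolP.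
exists (n + m)%N, (fun i => match fintype.split i with inl j => a * c j | inr j => d j end),
  (fun i => match fintype.split i with inl j => v j | inr j => w j end).
split=> [i|]; first by case: (fintype.split i).
rewrite big_split_ord /= scaler_sumr; congr +%R; apply: eq_bigr => i _.
  by rewrite (unsplitK (inl i)) scalerA.
by rewrite (unsplitK (inr i)).
Qed.

HB.instance Definition _ := GRing.isSubmodClosed.Build rat V span span_submod_closed.
End Span.

Section QuotientSpace.
Variables (V : lmodType rat) (S : set V).
Local Open Scope ring_scope.

Definition quotv := ring_quotient.Quotient.quot (span S).
HB.instance Definition _ := ZmodQuotient.on quotv.
HB.instance Definition _ := EqQuotient.on quotv.

Definition piv (x : V) : quotv := \pi_quotv x.

Lemma pivP x y : (piv x = piv y) <-> (x - y \in span S).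
Proof. by split=> [/eqmodP//|h]; apply/eqmodP. Qed.

Lemma pivK (a : quotv) : piv (repr a) = a. Proof. exact: reprK. Qed.

Lemma pivD : {morph piv : x y / x + y}.
Proof. by move=> x y; rewrite /piv !piE. Qed.

Definition scaleq (c : rat) (a : quotv) : quotv := piv (c *: repr a).

Lemma scaleqE c x : scaleq c (piv x) = piv (c *: x).
Proof. by have /pivP h := pivK (piv x); apply/pivP; rewrite -scalerBr rpredZ. Qed.

Lemma scaleqA c d a : scaleq c (scaleq d a) = scaleq (c * d) a.
Proof. by rewrite -(pivK a) !scaleqE scalerA. Qed.
Lemma scale1q : left_id 1 scaleq.
Proof. by move=> a; rewrite -(pivK a) scaleqE scale1r. Qed.
Lemma scaleqDr : right_distributive scaleq +%R.
Proof.
by move=> c a b; rewrite -(pivK a) -(pivK b) !(scaleqE, =^~ pivD) scalerDr.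
Qed.
Lemma scaleqDl a : {morph scaleq^~ a : c d / c + d}.
Proof. by move=> c d; rewrite -(pivK a) !(scaleqE, =^~ pivD) scalerDl. Qed.

HB.instance Definition _ := GRing.Zmodule_isLmodule.Build rat quotv
  scaleqA scale1q scaleqDr scaleqDl.

Lemma pivB : {morph piv : x y / x - y}.
Proof. by move=> x y; rewrite /piv !piE. Qed.
HB.instance Definition _ := GRing.isZmodMorphism.Build V quotv piv pivB.
Lemma pivZ : scalable piv.
Proof. by move=> c x; rewrite -scaleqE. Qed.
HB.instance Definition _ := GRing.isScalable.Build rat V quotv *:%R piv pivZ.
End QuotientSpace.

Definition finite_dim (V : lmodType rat) : Prop :=
  exists n (v : 'I_n -> V), forall x, exists c : 'I_n -> rat,
    (x = \sum_i c i *: v i)%R.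

Section TensorQ.
Variable A : groupType.
Local Open Scope ring_scope.

(* [A (x) Q] for an abelian group [A], written multiplicatively: the space
   generated by the symbols [a (x) 1] subject to additivity in [a]. *)
Definition tensorQ_rel : set {freeg A / rat} :=
  [set r | exists a b : A, r = << (a * b)%g >> - << a >> - << b >>].
Definition tensorQ := quotv tensorQ_rel.
HB.instance Definition _ := GRing.Lmodule.on tensorQ.

Definition tens (a : A) : tensorQ := piv tensorQ_rel << a >>.

Lemma tensM a b : tens (a * b)%g = tens a + tens b.
Proof.
rewrite /tens -pivD; apply/pivP; rewrite opprD addrA unfold_in.
apply/asboolP; exists 1%N, (fun=> 1), (fun=> << (a * b)%g >> - << a >> - << b >>).
by split=> [_|]; [exists a, b | rewrite big_ord1 scale1r].
Qed.

Lemma tens1 : tens 1%g = 0.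
Proof. by apply: (addrI (tens 1%g)); rewrite -tensM mulg1 addr0. Qed.

Lemma tensV a : tens a^-1%g = - tens a.
Proof. by apply/eqP; rewrite -addr_eq0 -tensM mulVg tens1. Qed.
End TensorQ.

Definition gen (G : groupType) (S : set G) : {pred G} := fun x =>
  `[< forall H : groupClosed G, (forall y, S y -> y \in H) -> x \in H >].

Definition finitely_generated (G : groupType) : Prop :=
  exists s : seq G, forall x, x \in gen [set` s].

Section LowerSeries.
Variable G : groupType.
Implicit Type N : nsgroup G.

Definition top_pred : {pred G} := predT.
Lemma top_closed : group_closed top_pred. Proof. by []. Qed.
Lemma top_conj x g : x \in top_pred -> x ^ g \in top_pred. Proof. by []. Qed.
Definition nstop : nsgroup G := NSGroup top_closed top_conj.

(* [N, G] *)
Definition comm_pred N : {pred G} :=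
  gen [set x | exists n g, n \in N /\ x = [~ n, g]].

Lemma comm_closed N : group_closed (comm_pred N).
Proof.
split=> [|x y /asboolP Hx /asboolP Hy]; apply/asboolP => H sH.
  exact: gpred1.
by apply: gpredF; [exact: Hx | exact: Hy].
Qed.

Lemma comm_conj N x g : x \in comm_pred N -> x ^ g \in comm_pred N.
Proof.
move=> /asboolP Hx; apply/asboolP => H sH.
pose Hg : {pred G} := [pred y | y ^ g \in H].
have Hgc : group_closed Hg.
  split=> [|u v]; rewrite !inE /= ?conj1g ?gpred1 // => Hu Hv.
  by rewrite conjMg conjVg gpredF.
pose mM := monoid.isMulClosed.Build G Hg (group_closedM Hgc).
pose m1 := monoid.isMul1Closed.Build G Hg Hgc.1.
pose mV := monoid.isInvClosed.Build G Hg (group_closedV Hgc).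
pose K : groupClosed G := HB.pack Hg mM m1 mV.
apply: (Hx K) => _ [n [h [Nn ->]]]; rewrite inE /= conjRg.
by apply: sH; exists (n ^ g), (h ^ g); split=> //; exact: ns_conj.
Qed.

Definition comm N : nsgroup G := NSGroup (@comm_closed N) (@comm_conj N).

(* the canonical map [N -> N/[N, G] (x) Q] *)
Definition toQ N (x : subg_of N) : tensorQ (sect N (comm N)) :=
  tens (pig (sectns N (comm N)) x).

Definition kerQ_pred N : {pred G} := fun x =>
  `[< exists y : subg_of N, subg_val y = x /\ toQ y = 0%R >].

Lemma toQM N : {morph @toQ N : x y / (x * y)%g >-> (x + y)%R}.
Proof. by move=> x y; rewrite /toQ pigM tensM. Qed.

Lemma toQV N x : @toQ N x^-1 = (- toQ x)%R.
Proof.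
apply/eqP; rewrite -GRing.addr_eq0 -toQM mulVg.
by apply/eqP; apply: (GRing.addrI (toQ 1)); rewrite -toQM mulg1 GRing.addr0.
Qed.

Lemma kerQ_closed N : group_closed (kerQ_pred N).
Proof.
split=> [|_ _ /asboolP[x [<- x0]] /asboolP[y [<- y0]]]; apply/asboolP.
  exists 1; split=> //.
  by apply: (GRing.addrI (toQ 1)); rewrite -toQM mulg1 GRing.addr0.
by exists (x / y); split=> //; rewrite toQM toQV x0 y0 GRing.subr0.
Qed.

Lemma kerQ_conj N x g : x \in kerQ_pred N -> x ^ g \in kerQ_pred N.
Proof.
move=> /asboolP[[y Ny] [/= <- y0]]; apply/asboolP.
exists (Subg (ns_conj g Ny)); split=> //; rewrite -y0; congr tens.
apply/pigP; rewrite inE /=.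
have -> : (y ^ g)^-1 * y = [~ y, g]^-1.
  by rewrite -{2}(invgK y); exact: esym (invgM _ _).
by move=> H sH; rewrite gpredV; apply: sH; exists y, g.
Qed.

Definition kerQ N : nsgroup G := NSGroup (@kerQ_closed N) (@kerQ_conj N).

(* [lcs i] and [lcsQ i] are the terms of index [i.+1] of the lower central and
   of the lower Q-central series, which are classically indexed from 1. *)
Definition lcs (i : nat) : nsgroup G := iter i comm nstop.
Definition lcsQ (i : nat) : nsgroup G := iter i kerQ nstop.

Definition nilpotent : Prop := exists c, forall x, x \in lcs c -> x = 1.

Definition Qprenilpotent : Prop :=
  exists k, forall i, (k <= i)%N -> lcsQ i =i lcsQ i.+1.

End LowerSeries.

HB.mixin Record isTopGroup G & monoid.Group G & Topological G := {
  mulg_continuous : continuous (fun xy : G * G => xy.1 * xy.2);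
  invg_continuous : continuous (fun x : G => x^-1) }.

#[short(type="topGroupType")]
HB.structure Definition TopGroup :=
  { G of monoid.Group G & Topological G & isTopGroup G }.

Section InverseLimit.
Variables (X : nat -> groupType) (t : forall i, {multiplicative X i.+1 -> X i}).

Record invlim := InvLim {
  coord : forall i, X i;
  coordP : forall i, t i (coord i.+1) = coord i }.

HB.instance Definition _ := gen_eqMixin invlim.
HB.instance Definition _ := gen_choiceMixin invlim.

Lemma invlim_ext x y : coord x = coord y -> x = y.
Proof.
by case: x y => [x xP] [y yP] /= e; subst y; congr InvLim; exact: Prop_irrelevance.
Qed.

Lemma t1 i : t i 1 = 1.
Proof. by apply: (mulgI (t i 1)); rewrite -gmulfM !mulg1. Qed.
Lemma tV i x : t i x^-1 = (t i x)^-1.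
Proof. by apply: (mulgI (t i x)); rewrite -gmulfM !mulgV t1. Qed.

Lemma lim_mulP (x y : invlim) i :
  t i (coord x i.+1 * coord y i.+1) = coord x i * coord y i.
Proof. by rewrite gmulfM !coordP. Qed.
Lemma lim_invP (x : invlim) i : t i (coord x i.+1)^-1 = (coord x i)^-1.
Proof. by rewrite tV coordP. Qed.

Definition lim_one := InvLim (fun i => t1 i).
Definition lim_mul x y := InvLim (lim_mulP x y).
Definition lim_inv x := InvLim (lim_invP x).

Lemma lim_mulA : associative lim_mul.
Proof. by move=> x y z; apply/invlim_ext/functional_extensionality_dep => i; exact: mulgA. Qed.
Lemma lim_mul1 : left_id lim_one lim_mul.
Proof. by move=> x; apply/invlim_ext/functional_extensionality_dep => i; exact: mul1g. Qed.
Lemma lim_1mul : right_id lim_one lim_mul.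
Proof. by move=> x; apply/invlim_ext/functional_extensionality_dep => i; exact: mulg1. Qed.
Lemma lim_mulV : left_inverse lim_one lim_inv lim_mul.
Proof. by move=> x; apply/invlim_ext/functional_extensionality_dep => i; exact: mulVg. Qed.
Lemma lim_Vmul : right_inverse lim_one lim_inv lim_mul.
Proof. by move=> x; apply/invlim_ext/functional_extensionality_dep => i; exact: mulgV. Qed.

HB.instance Definition _ :=
  isGroup.Build invlim lim_mulA lim_mul1 lim_1mul lim_mulV lim_Vmul.

HB.instance Definition _ := Topological.copy invlim
  (initial_topology
     (coord : invlim -> prod_topology (fun i => discrete_topology (X i)))).

Lemma invlim_nbhsP (x : invlim) (A : set invlim) :
  nbhs x A <->
  exists n, forall y, (forall i, (i < n)%N -> coord y i = coord x i) -> A y.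
Proof.
split=> [|[n nA]]; last first.
  have : nbhs x [set y | forall i, (i < n)%N -> coord y i = coord x i].
    elim: n {nA} => [|n IH]; first by apply: filterS filterT.
    have xn : nbhs x [set y | coord y n = coord x n].
      have /= c1 := @initial_continuous invlim
        (prod_topology (fun i => discrete_topology (X i))) coord x.
      have c2 := @proj_continuous _ (fun i => discrete_topology (X i)) n (coord x).
      by apply: (c1 _ (c2 [set coord x n] _)).
    apply: filterS (filterI IH xn) => y [/= yi yn] i.
    by rewrite ltnS leq_eqVlt => /predU1P[->//|/yi].
  exact: filterS.
rewrite nbhsE => -[_ [[U Uo <-] Ux] UA].
pose F : set_system (prod_topology (fun i => discrete_topology (X i))) :=
  [set V | exists n, forall q : forall i, X i, (forall i, (i < n)%N -> q i = coord x i) -> V q].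
have FF : Filter F.
  split=> [|P Q [n nP] [m mQ]|P Q PQ [n nP]]; first by exists 0%N.
    exists (maxn n m) => q qx.
    split; [apply: nP|apply: mQ] => i im; apply: qx; rewrite leq_max im ?orbT //.
  by exists n => q /nP /PQ.
have Fx : F --> (coord x : prod_topology (fun i => discrete_topology (X i))).
  apply/cvg_sup => i B; rewrite nbhsE => -[_ [[V Vo <-] Vx] VB].
  exists i.+1 => q qx; apply: VB => /=; rewrite /preimage /= qx //.
have [|n nU] := Fx U; first by apply: open_nbhs_nbhs.
by exists n => y yx; apply: UA; exact: nU.
Qed.
End InverseLimit.

Section InverseLimitTop.
Variables (X : nat -> groupType) (t : forall i, {multiplicative X i.+1 -> X i}).
Local Notation L := (invlim t).

Lemma invlim_mul_continuous : continuous (fun xy : L * L => xy.1 * xy.2).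
Proof.
move=> [x y] A /invlim_nbhsP[n nA].
exists ([set z | forall i, (i < n)%N -> coord z i = coord x i],
        [set z | forall i, (i < n)%N -> coord z i = coord y i]).
  by split; apply/invlim_nbhsP; exists n.
by move=> [u v] [/= ux vy]; apply: nA => i im; congr (_ * _); [apply: ux|apply: vy].
Qed.

Lemma invlim_inv_continuous : continuous (fun x : L => x^-1).
Proof.
move=> x A /invlim_nbhsP[n nA]; apply/invlim_nbhsP; exists n => y yx.
by apply: nA => i im; congr (_^-1); exact: yx.
Qed.

HB.instance Definition _ :=
  isTopGroup.Build L invlim_mul_continuous invlim_inv_continuous.
End InverseLimitTop.

Section Uniformity.
Variable G : topGroupType.

Definition left_entourage : set_system (G * G) :=
  filter_from (nbhs (1 : G)) (fun V => [set xy | V (xy.1^-1 * xy.2)]).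
Definition right_entourage : set_system (G * G) :=
  filter_from (nbhs (1 : G)) (fun V => [set xy | V (xy.2 * xy.1^-1)]).

Definition uniformities_coincide : Prop := left_entourage = right_entourage.

Lemma left_entourage_filter : Filter left_entourage.
Proof.
apply: filter_from_filter; first by exists setT; exact: filterT.
by move=> A B nA nB; exists (A `&` B); first exact: filterI.
Qed.

Lemma left_entourage_diag A : left_entourage A -> diagonal `<=` A.
Proof.
move=> [V nV VA] [x y] /= /diagonalP ->; apply: VA => /=.
by rewrite mulVg; exact: nbhs_singleton.
Qed.

Lemma left_entourage_inv A : left_entourage A -> left_entourage A^-1%relation.
Proof.
move=> [V nV VA]; exists [set v : G | V v^-1].
  by apply: (@invg_continuous G 1 V); rewrite invg1.
by move=> [x y] /= Vyx; apply: VA => /=; have -> : y^-1 * x = (x^-1 * y)^-1 by rewrite invgM invgK.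
Qed.

Lemma left_entourage_split A :
  left_entourage A -> exists2 B, left_entourage B & (B \; B `<=` A)%relation.
Proof.
move=> [V nV VA].
have /= : nbhs ((1, 1) : G * G) [set xy | V (xy.1 * xy.2)].
  by apply: (@mulg_continuous G (1, 1) V); rewrite /= mulg1.
move=> [[P Q] [/= nP nQ] PQ].
exists [set xy | (P `&` Q) (xy.1^-1 * xy.2)].
  by exists (P `&` Q) => //; exact: filterI.
move=> [x z] [y /= [Pxy _] [_ Qyz]]; apply: VA => /=.
have := PQ (x^-1 * y, y^-1 * z) (conj Pxy Qyz).
by rewrite /= mulgA mulgK.
Qed.

Lemma left_entourage_nbhs : @nbhs G G = nbhs_ left_entourage.
Proof.
apply/funext => x; apply/seteqP; split=> A.
  move=> nA; exists [set xy : G * G | A (x * (xy.1^-1 * xy.2))].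
    exists [set v | A (x * v)] => //.
    have /= : nbhs ((x, 1) : G * G) [set xy | A (xy.1 * xy.2)].
      by apply: (@mulg_continuous G (x, 1) A); rewrite /= mulg1.
    move=> [[P Q] [/= nP nQ] PQ]; apply: filterS nQ => v Qv.
    by apply: (PQ (x, v)); split=> //=; exact: nbhs_singleton.
  by move=> y /xsectionP /=; rewrite mulVKg.
move=> [E [V nV VE] EA].
have /= : nbhs ((x^-1, x) : G * G) [set xy | V (xy.1 * xy.2)].
  by apply: (@mulg_continuous G (x^-1, x) V); rewrite /= mulVg.
move=> [[P Q] [/= nP nQ] PQ]; apply: filterS nQ => v Qv.
apply: EA; apply/xsectionP; apply: VE => /=.
by apply: (PQ (x^-1, v)); split=> //=; exact: nbhs_singleton.
Qed.

Definition left_uniform : Type := G.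
HB.instance Definition _ := Topological.on left_uniform.
HB.instance Definition _ := Nbhs_isUniform.Build left_uniform
  left_entourage_filter left_entourage_diag left_entourage_inv
  left_entourage_split left_entourage_nbhs.
End Uniformity.

(* The definitions below use the left uniform structure; for inverse limits of
   discrete groups it is also the right one. *)
Lemma invlim_uniformities (X : nat -> groupType)
    (t : forall i, {multiplicative X i.+1 -> X i}) :
  uniformities_coincide (invlim t).
Proof.
apply/seteqP; split=> A [V /invlim_nbhsP[n nV] VA];
  exists [set z | forall i, (i < n)%N -> coord z i = 1];
  try (by apply/invlim_nbhsP; exists n);
  move=> [x y] /= xy; apply: VA; apply: nV => i /xy /=.
  by move=> /(canRL (mulgVK _)); rewrite mul1g => e; exact: etrans (congr1 _ e) (mulVg _).
by move=> /(canRL (mulVKg _)); rewrite mulg1 => e; exact: etrans (congr1 (fun u => u / _) e) (mulgV _).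
Qed.

Section Faces.
Variable G : groupType.

(* [face i x] deletes the first entry of [x] when [i = 0] and the last one when
   [i = n.+1]; otherwise it multiplies the consecutive entries [i.-1] and [i]. *)
Definition face n (i : 'I_n.+2) (x : 'I_n.+1 -> G) : 'I_n -> G := fun j =>
  let x0 := x (widen_ord (leqnSn n) j) in
  let x1 := x (fintype.lift ord0 j) in
  if (j.+1 < i)%N then x0 else if (j.+1 == i)%N then x0 * x1 else x1.

Definition cochain n : Type := ('I_n -> G) -> rat.

Definition dcochain n (f : cochain n) : cochain n.+1 := fun x =>
  (\sum_(i < n.+2) (-1) ^+ i * f (face i x))%R.

Definition cocycle n (f : cochain n) : Prop := forall x, dcochain f x = 0%R.

(* [f] is the coboundary of a cochain satisfying [P] *)
Definition coboundary (P : forall n, cochain n -> Prop) n :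
    cochain n -> Prop :=
  match n with
  | 0 => fun f => forall x, f x = 0%R
  | m.+1 => fun f => exists h : cochain m, P m h /\ f = dcochain h
  end.

Definition any_cochain n (f : cochain n) : Prop := True.
End Faces.

Section UniformCohomology.
Variable G : topGroupType.

Definition uniform_cochain n (f : cochain G n) : Prop :=
  unif_continuous
    (f : prod_topology (fun _ : 'I_n => left_uniform G) -> discrete_topology rat).

(* [H^m_u(G, Q) -> H^m(G, Q)] is injective and surjective, for all m *)
Definition cohomologically_discrete : Prop := forall m,
  (forall f : cochain G m, uniform_cochain f -> cocycle f ->
     coboundary (@any_cochain G) f -> coboundary uniform_cochain f) /\
  (forall f : cochain G m, cocycle f ->
     exists f' : cochain G m, [/\ uniform_cochain f', cocycle f' &
       coboundary (@any_cochain G) (fun x => f x - f' x)%R]).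
End UniformCohomology.

Section Homology.
Local Open Scope ring_scope.

Definition chain (G : groupType) n : lmodType rat := {freeg ('I_n -> G) / rat}.

Definition bdry (G : groupType) n : chain G n.+1 -> chain G n :=
  fglift (fun x => \sum_(i < n.+2) (-1) ^+ i *: << face i x >>).

Definition chain_map (G H : groupType) (f : G -> H) n : chain G n -> chain H n :=
  fglift (fun x => << f \o x >>).

Definition is_cycle (G : groupType) n : chain G n -> Prop :=
  match n with 0 => fun=> True | m.+1 => fun z => bdry z = 0 end.

Definition is_bdry (G : groupType) n (z : chain G n) : Prop :=
  exists w : chain G n.+1, z = bdry w.

Variables (G H : groupType) (f : {multiplicative G -> H}).

(* the map [H_n(G, Q) -> H_n(H, Q)] induced by f is injective, surjective *)
Definition homology_inj n : Prop :=
  forall z : chain G n, is_cycle z -> is_bdry (chain_map f z) -> is_bdry z.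
Definition homology_surj n : Prop :=
  forall w : chain H n, is_cycle w ->
    exists z : chain G n, is_cycle z /\ is_bdry (w - chain_map f z).

Definition HQ_map : Prop := [/\ homology_inj 1, homology_surj 1 & homology_surj 2].
End Homology.

(* [l] is terminal among the HQ-maps out of [G] *)
Definition HQ_localization (G L : groupType) (l : {multiplicative G -> L}) : Prop :=
  HQ_map l /\
  forall (K : groupType) (f : {multiplicative G -> K}), HQ_map f ->
    exists g : {multiplicative K -> L}, (forall x, g (f x) = l x) /\
      forall g' : {multiplicative K -> L}, (forall x, g' (f x) = l x) -> g' =1 g.

Definition uniquely_divisible (M : groupType) : Prop :=
  forall n, (0 < n)%N -> bijective (fun x : M => x ^+ n).

(* Malcev's definition of the rationalization of a nilpotent group [N], which
   determines [phi] up to a unique isomorphism under [N]. *)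
Definition malcev_completion (N M : groupType) (phi : {multiplicative N -> M}) : Prop :=
  [/\ nilpotent M, uniquely_divisible M,
      forall x, phi x = 1 <-> exists n, (0 < n)%N /\ x ^+ n = 1 &
      forall y, exists n x, (0 < n)%N /\ y ^+ n = phi x].

(* The tower of the Malcev completions of the groups [G / lcsQ G i]; the maps
   [qtrans] are determined by [qtransE]. *)
Record Qtower (G : groupType) := QTower {
  qgrp : nat -> groupType;
  qmap : forall i, {multiplicative quotg (lcsQ G i) -> qgrp i};
  qmapP : forall i, malcev_completion (qmap i);
  qtrans : forall i, {multiplicative qgrp i.+1 -> qgrp i};
  qtransE : forall i (x : G), qtrans i (qmap i.+1 (pig _ x)) = qmap i (pig _ x) }.

Section Completion.
Variables (G : groupType) (T : Qtower G).

Definition Qcompletion : topGroupType := invlim (qtrans T).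

Definition to_Qcompletion (x : G) : Qcompletion :=
  InvLim (fun i => qtransE T i x).

Lemma to_QcompletionM : {morph to_Qcompletion : x y / x * y}.
Proof.
by move=> x y; apply/invlim_ext/functional_extensionality_dep => i /=; rewrite !gmulfM.
Qed.
HB.instance Definition _ :=
  isMultiplicative.Build G Qcompletion to_Qcompletion to_QcompletionM.

(* The map [h] is the natural one from the HQ-localization to the
   Q-completion: a bijective [h] is the only homomorphism such that
   [h \o l = to_Qcompletion], by the universal property of [l]. *)
Definition HQ_good : Prop :=
  exists (L : groupType) (l : {multiplicative G -> L}),
    HQ_localization l /\
    exists h : {multiplicative L -> Qcompletion},
      (forall x, h (l x) = to_Qcompletion x) /\ bijective h.
End Completion.

Definition abelian_group (A : groupType) : Prop := forall x y : A, x * y = y * x.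

(* Main.v *)
Require Import Defs.
From HB Require Import structures.
From mathcomp Require Import all_boot all_order all_algebra.
From mathcomp Require Import all_classical topology.
From mathcomp Require Import freeg lra.

(* The lower Q-central series stabilises, at index [k] say, because its
   torsion-free sections are detected on the finitely many [U j / U j.+1], each
   of finite rank.  The tower of Malcev completions is then eventually constant,
   so the completion [M] is discrete and every cochain on it is uniformly
   continuous.

   Call [f : G -> K] Q-local when every homomorphism from [G] to a uniquely
   divisible nilpotent group [N] extends uniquely along [f].
   - [G -> M] is Q-local: a homomorphism to [N] kills [lcsQ G k], and the
     isolator of its graph in [M * N] is a subgroup, the graph of the extension.
   - If [M] is nilpotent and uniquely divisible, a Q-local [G -> M] is an HQ-map:
     by duality over [rat] this concerns homomorphisms to [rat] and central
     extensions of [M] by [rat], which are again admissible targets.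
   - Every HQ-map is Q-local, by induction on the class of [N]: lifting a
     homomorphism from [N / Z(N)] to [N] is a question on [H^1] and [H^2] with
     coefficients in the rational vector space [Z(N)].
   Hence [G -> M] is itself the HQ-localization. *)

Set Implicit Arguments.
Unset Strict Implicit.
Unset Printing Implicit Defensive.

Import GRing.Theory Num.Theory.
Local Open Scope group_scope.
Local Open Scope quotient_scope.
Local Open Scope classical_set_scope.

(** * Linear relations over the rationals *)

(** By Zorn's lemma [R] lies in a maximal single-valued linear relation; if some vector had no
    image, giving it the image 0 would enlarge the relation. This replaces the choice of bases in
    the duality arguments. *)
Lemma linear_relation_extends (V W : lmodType rat) (R : set (V * W)) :
  R 0%R -> (forall a p q, R p -> R q -> R (a *: p + q)%R) ->
  (forall w, R (0%R, w) -> w = 0%R) ->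
  exists f : {linear V -> W}, forall v w, R (v, w) -> f v = w.
Proof.
move=> R0 Rlin Rfun.
pose good (T : set (V * W)) :=
  [/\ T 0%R, (forall a p q, T p -> T q -> T (a *: p + q)%R) &
      (forall w, T (0%R, w) -> w = 0%R)].
(* Zorn's lemma runs over the sets to be added to [R], so that the empty chain yields [R] itself. *)
have [F FP Ftot|A [[T0 Tlin Tfun] Amax]] :=
    @Zorn_bigcup (V * W)%type (fun S => good (R `|` S)).
  have [F0|[X0 FX0]] : F = set0 \/ exists X, F X.
    by have [->|/set0P] := eqVneq F set0; [left|right].
    by rewrite F0 bigcup_set0 setU0; split.
  have join p q : (R `|` \bigcup_(X in F) X) p -> (R `|` \bigcup_(X in F) X) q ->
      exists X, [/\ F X, (R `|` X) p & (R `|` X) q].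
    move=> [Rp|[X FX Xp]] [Rq|[Y FY Yq]].
    - by exists X0; split=> //; left.
    - by exists Y; split=> //; [left|right].
    - by exists X; split=> //; [right|left].
    - have [XY|YX] := Ftot X Y FX FY.
        by exists Y; split=> //; right=> //; exact: XY.
      by exists X; split=> //; right=> //; exact: YX.
  split=> [|a p q Hp Hq|w Hw]; first by left.
    have [X [FX Xp Xq]] := join p q Hp Hq.
    have [_ /(_ a p q Xp Xq) [Rpq|Xpq] _] := FP X FX; first by left.
    by right; exists X.
  have [X [FX Xw _]] := join _ _ Hw Hw.
  by have [_ _ ] := FP X FX; apply.
set T := R `|` A in T0 Tlin Tfun.
have Ttot v : exists w, T (v, w).
  apply: contrapT => nv.
  pose T' : set (V * W) := [set p | exists c u, T (u, p.2) /\ p.1 = (u + c *: v)%R].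
  have TT' : T `<=` T'.
    by move=> [u w] Tuw; exists 0%R, u; rewrite scale0r addr0.
  have T'v : T' (v, 0%R).
    by exists 1%R, 0%R; split=> //; rewrite add0r scale1r.
  apply: (Amax T').
    split=> [|T'A]; first by move=> p Ap; apply: TT'; right.
    by apply: nv; exists 0%R; right; exact: T'A.
  have -> : R `|` T' = T'.
    by apply/seteqP; split=> [p [Rp|//]|p]; [apply: TT'; left|right].
  split=> [|a [u w] [u' w'] [c [x [Tx /= ->]]] [d [y [Ty /= ->]]]|w].
  - exact: TT'.
  - exists (a * c + d)%R, (a *: x + y)%R; split; first exact: (Tlin a _ _ Tx Ty).
    by rewrite /= scalerDr scalerDl -!addrA; congr (_ + _)%R; rewrite scalerA addrCA.
  - move=> [c [u [Tu /esym]]] /=; have [->|c0] := eqVneq c 0%R.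
      by rewrite scale0r addr0 => e; apply: Tfun; rewrite -e.
    (* If [u + c *: v = 0] with [c] nonzero, linearity already provides an image of [v], namely
       [- c^-1 *: w]. *)
    move=> /eqP; rewrite addr_eq0 => /eqP e; case: nv.
    exists ((- c^-1) *: w)%R.
    have := Tlin (- c^-1)%R _ _ Tu T0; rewrite addr0 e.
    rewrite /GRing.scale /= /scale_pair /=.
    by rewrite scalerN scaleNr opprK scalerA mulVf // scale1r.
have Tfun2 v w w' : T (v, w) -> T (v, w') -> w = w'.
  move=> Tw Tw'; apply/eqP; rewrite -subr_eq0; apply/eqP; apply: Tfun.
  suff <- : (-1 *: (v, w') + (v, w) = (0, w - w'))%R by exact: Tlin.
  have -> : (0, w - w')%R = (-1 *: v + v, -1 *: w' + w)%R; last by [].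
  by rewrite !scaleN1r addNr addrC.
have [f fT] := choice Ttot.
have flin : GRing.linear_for *:%R f.
  move=> a x y; apply: (Tfun2 (a *: x + y)%R); first exact: fT.
  exact: (Tlin a _ _ (fT x) (fT y)).
pose m := GRing.isLinear.Build rat V W *:%R f flin.
pose fL : {linear V -> W} := HB.pack f m.
by exists fL => v w Rvw; apply: (Tfun2 v) => //; left.
Qed.

(** The relation between [d z] and [c z] is single valued, so it extends. When [d] is a boundary
    map, this says that a cochain vanishing on cycles is a coboundary. *)
Lemma linear_factor (C C' W : lmodType rat) (d : {linear C -> C'})
    (c : {linear C -> W}) :
  (forall z, d z = 0%R -> c z = 0%R) ->
  exists b : {linear C' -> W}, forall z, b (d z) = c z.
Proof.
move=> dc.
have [||w [z [/= dz wz]]|b bP] := @linear_relation_extends C' W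
    [set p | exists z, p.1 = d z /\ p.2 = c z].
- by exists 0%R; rewrite !linear0.
- move=> a [x y] [x' y'] [z [/= -> ->]] [z' [/= -> ->]].
  by exists (a *: z + z')%R; rewrite !linearP.
- by rewrite wz; apply: dc.
- by exists b => z; apply: bP; exists z.
Qed.

(** Sending [s + t *: x] to [t] is single valued because [x] is not in [S]. This gives a cocycle
    that detects a given nonzero homology class. *)
Lemma linear_separation (V : lmodType rat) (S : set V) (x : V) :
  S 0%R -> (forall a u v, S u -> S v -> S (a *: u + v)%R) -> ~ S x ->
  exists l : {linear V -> rat^o}, (forall s, S s -> l s = 0%R) /\ l x = 1%R.
Proof.
move=> S0 Slin nSx.
have [||w|l lP] := @linear_relation_extends V rat^o
    [set p | S (p.1 - p.2 *: x)%R].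
- by rewrite /= scale0r subr0.
- move=> a [u s] [v t] /= Su Sv; have := Slin a _ _ Su Sv.
  suff -> : (a *: (u - s *: x) + (v - t *: x) = a *: u + v - (a * s + t) *: x)%R by [].
  by rewrite scalerDl -scalerA scalerBr opprD addrACA.
- rewrite /= sub0r => Sw; apply: contrapT => /eqP w0; apply: nSx.
  have := Slin (- w^-1)%R _ _ Sw S0.
  by rewrite addr0 scalerN scaleNr opprK scalerA mulVf // scale1r.
exists l; split=> [s Ss|]; apply: lP => /=; first by rewrite scale0r subr0.
by rewrite scale1r subrr.
Qed.

Lemma fglift_linear (K : choiceType) (M : lmodType rat) (f : K -> M) :
  GRing.linear_for *:%R (fglift f : {freeg K / rat} -> M).
Proof.
move=> a D D'.
have fgB := @lift_is_additive rat K M f.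
have fg0 : fglift f (0 : {freeg K / rat})%R = 0%R.
  by have := fgB 0%R 0%R; rewrite !subrr.
have fgD : {morph (fglift f : {freeg K / rat} -> M) : x y / (x + y)%R}.
  move=> x y; have := fgB x (0 - y)%R; rewrite (fgB 0%R y) fg0 !sub0r.
  by rewrite !opprK.
rewrite fgD; congr (_ + _)%R.
rewrite -{1}(freeg_sumE D) scaler_sumr -{3}(freeg_sumE D).
rewrite (big_morph _ fgD fg0) (big_morph _ fgD fg0) scaler_sumr.
apply: eq_bigr => x _.
have -> : (a *: << coeff x D *g x >> = << a * coeff x D *g x >>)%R.
  by apply/eqP/freeg_eqP => y; rewrite coeffZ !coeffU mulrA.
by rewrite !liftU scalerA.
Qed.

HB.instance Definition _ (K : choiceType) (M : lmodType rat) (f : K -> M) :=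
  GRing.isLinear.Build rat {freeg K / rat} M *:%R (fglift f) (fglift_linear f).

Lemma fglift1 (K : choiceType) (M : lmodType rat) (f : K -> M) x :
  fglift f << x >> = f x.
Proof. by rewrite liftU scale1r. Qed.

Lemma freegU_scale (K : choiceType) (c : rat) (x : K) :
  << c *g x >> = (c *: << x >>)%R :> {freeg K / rat}.
Proof. by apply/eqP/freeg_eqP => y; rewrite coeffZ !coeffU mul1r. Qed.

Lemma freeg_ind_linear (K : choiceType) (M : lmodType rat)
    (f g : {linear {freeg K / rat} -> M}) :
  (forall x, f << x >> = g << x >>) -> f =1 g.
Proof.
move=> fg D; rewrite -(freeg_sumE D) !linear_sum; apply: eq_bigr => x _.
by rewrite freegU_scale !linearZ fg.
Qed.

(** * Torsion and tensor products *)

Lemma natr_denq (q : rat) : ((`|denq q|%N)%:R = (denq q)%:~R :> rat)%R.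
Proof. by rewrite pmulrn absz_denq. Qed.

Lemma common_denominator (n : nat) (c : 'I_n -> rat) :
  exists N, (0 < N)%N /\ forall i, exists m : int, (N%:R * c i = m%:~R)%R.
Proof.
exists (\prod_i `|denq (c i)|)%N; split=> [|i].
  by rewrite prodn_gt0 // => i; rewrite absz_gt0 denq_neq0.
rewrite (bigD1 i) //=; set N := (\prod_(j | _) _)%N.
exists (N%:Z * numq (c i))%R.
rewrite natrM mulrAC natr_denq -{2}(divq_num_den (c i)) (mulrC (denq _)%:~R%R).
by rewrite mulfVK ?intr_eq0 ?denq_neq0 // mulrC intrM.
Qed.

Section Additive.
Variable A : groupType.

(** The proof of commutativity is a parameter of the type, so that a Z-module structure can be
    attached to it. *)
Definition additive_group of abelian_group A : Type := A.

Variable cA : abelian_group A.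
HB.instance Definition _ := Choice.copy (additive_group cA) A.
HB.instance Definition _ := GRing.isZmodule.Build (additive_group cA)
  (@mulgA A) cA (@mul1g A) (@mulVg A).

Lemma additive_mulrn (a : A) n : ((a : additive_group cA) *+ n)%R = a ^+ n :> A.
Proof. by elim: n => // n IHn; rewrite mulrS expgS -IHn. Qed.
End Additive.

(** Clearing denominators in an expression of [<< a >>] as a combination of relations gives an
    identity of integral chains. Evaluated in [A] it reads [a ^+ N = 1], since every relation
    evaluates to the unit. *)
Lemma tens_eq0 (A : groupType) (a : A) : abelian_group A ->
  tens a = 0%R -> exists n, (0 < n)%N /\ a ^+ n = 1.
Proof.
move=> cA; rewrite -[0%R](raddf0 (piv (@tensorQ_rel A))) => /pivP.
rewrite subr0 => /asboolP[m [c [v [/choice[y yP] aE]]]].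
have [z {}yP] := choice yP.
have [N [N0 /choice[n nP]]] := common_denominator c.
exists N; split=> //.
pose B := additive_group cA.
have coefE x : ((N * (a == x))%N%:Z =
    \sum_i n i * ((y i * z i == x)%g%:Z - (y i == x)%:Z - (z i == x)%:Z))%R.
  apply: (@intr_inj rat).
  have := congr1 (fun D => N%:R * coeff x D)%R aE.
  rewrite coeffU mul1r -natrM -pmulrn => ->.
  rewrite !raddf_sum mulr_sumr /=; apply: eq_bigr => i _.
  rewrite coeffZ mulrA nP rmorphM; congr (_ * _)%R.
  by rewrite yP !coeffB !coeffU !mul1r !rmorphB /= -!pmulrn.
(* Evaluating chains in [A] on a fixed finite set of symbols, large enough for
   all the relations involved, is additive on integral chains. *)
pose s := undup (a :: [seq (y i * z i) | i : 'I_m] ++ codom y ++ codom z).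
have sumE (k : int) (b : A) : b \in s ->
    (\sum_(x <- s) (x : B) *~ (k * (b == x)%:Z) = (b : B) *~ k)%R.
  move=> bs; rewrite (bigD1_seq b) ?undup_uniq //= eqxx mulr1 big1 ?addr0 //.
  by move=> x /negPf; rewrite eq_sym => ->; rewrite mulr0.
rewrite -(additive_mulrn cA) pmulrn -sumE; last first.
  by rewrite mem_undup mem_head.
transitivity (\sum_(x <- s) \sum_i (x : B) *~
    (n i * ((y i * z i == x)%g%:Z - (y i == x)%:Z - (z i == x)%:Z)))%R.
  apply: eq_bigr => x _; rewrite -mulrz_sumr -coefE.
  by rewrite PoszM.
rewrite exchange_big big1 // => i _.
under eq_bigr do rewrite !mulrBr !mulrzBr.
rewrite !sumrB !sumE ?mem_undup ?inE ?mem_cat ?codom_f ?orbT //.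
  by rewrite -!mulrzBl (_ : (y i * z i)%g = (y i : B) + (z i : B))%R // -addrA -opprD subrr mul0rz.
Qed.

(** One vector more than a spanning family contains gives a dependence, integral after clearing
    denominators. The sum starts at the first nonzero coefficient, whose term is the one isolated
    later in the central series. *)
Lemma integral_dependence (V : lmodType rat) : finite_dim V ->
  exists d, forall v : nat -> V, exists k (n : nat -> int),
    [/\ (k < d)%N, n k <> 0%R & (\sum_(k <= i < d) v i *~ n i = 0)%R].
Proof.
move=> [d [u uP]]; exists d.+1 => v.
have [C CP] := choice uP.
pose M := (\matrix_(i < d.+1, j < d) C (v i) j)%R.
have /rowV0Pn[c /sub_kermxP cM c0] : kermx M != 0%R.
  rewrite kermx_eq0 /row_free neq_ltn ltnS; apply/orP; left.
  exact: rank_leq_col.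
have cv : (\sum_i c ord0 i *: v i = 0)%R.
  under eq_bigr do rewrite [v _]CP scaler_sumr.
  rewrite exchange_big big1 // => j _.
  under eq_bigr do rewrite scalerA.
  rewrite -scaler_suml; have := congr1 (fun A : 'rV[rat]_d => A ord0 j) cM.
  rewrite !mxE; under eq_bigr do rewrite mxE.
  by move=> ->; rewrite scale0r.
have [N [N0 /choice[m mP]]] := common_denominator (c ord0).
pose n i := m (inord i).
have nP (i : 'I_d.+1) : (N%:R * c ord0 i = (n i)%:~R)%R.
  by rewrite mP /n inord_val.
have nv : (\sum_(0 <= i < d.+1) v i *~ n i = 0)%R.
  rewrite big_mkord; transitivity (N%:R *: \sum_i c ord0 i *: v i)%R.
    rewrite scaler_sumr; apply: eq_bigr => i _.
    by rewrite scalerA nP scaler_int.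
  by rewrite cv scaler0.
have exn : exists i, (i < d.+1)%N && (n i != 0%R).
  have /existsP[i ci] : [exists i, c ord0 i != 0%R].
    apply: contraNT c0; rewrite negb_exists => /forallP c0.
    by apply/eqP/rowP => i; rewrite mxE; apply/eqP/negPn.
  exists i; rewrite ltn_ord /=; apply: contra ci => /eqP n0.
  by have /eqP := nP i; rewrite n0 mulf_eq0 pnatr_eq0 -leqn0 leqNgt N0.
have [k /andP[kd /eqP nk] kmin] := ex_minnP exn.
exists k, n; split=> //.
rewrite (big_cat_nat (n := k)) ?addr0 //= in nv; last exact: ltnW.
rewrite big1_seq ?add0r // in nv => i; rewrite mem_index_iota => /and3P[_ _ ik].
have [->|ni] := eqVneq (n i) 0%R; first by rewrite mulr0z.
by have := kmin i; rewrite ni (ltn_trans ik kd) leqNgt ik => /(_ isT).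
Qed.

(** * The lower Q-central series *)

Definition expgz (G : groupType) (x : G) (n : int) : G :=
  match n with Posz m => x ^+ m | Negz m => x ^- m.+1 end.

Section GroupMorphism.
Variables (G H : groupType) (f : {multiplicative G -> H}).

Lemma hom1 : f 1 = 1.
Proof. by apply: (mulgI (f 1)); rewrite -gmulfM !mulg1. Qed.

Lemma homV : {morph f : x / x^-1}.
Proof. by move=> x; apply: (mulgI (f x)); rewrite -gmulfM !mulgV hom1. Qed.

Lemma homX n : {morph f : x / x ^+ n}.
Proof. by move=> x; elim: n => [|n IHn]; rewrite ?hom1 // !expgS gmulfM IHn. Qed.

Lemma homJ : {morph f : x y / x ^ y}.
Proof. by move=> x y; rewrite !conjgE !gmulfM homV. Qed.

Lemma homR : {morph f : x y / [~ x, y]}.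
Proof. by move=> x y; rewrite !commgEl gmulfM homV homJ. Qed.

Lemma hom_prod I r (P : pred I) E :
  f (\prod_(i <- r | P i) E i) = \prod_(i <- r | P i) f (E i).
Proof. exact: (big_morph f (@gmulfM _ _ f) hom1). Qed.

Lemma hom_inj : (forall x, f x = 1 -> x = 1) -> injective f.
Proof. by move=> fI x y xy; apply/divg1_eq/fI; rewrite gmulfM homV xy mulgV. Qed.
End GroupMorphism.

Section AdditiveMorphism.
Variables (G : groupType) (V : zmodType) (f : G -> V).
Hypothesis fM : {morph f : x y / x * y >-> (x + y)%R}.

Lemma amorph1 : f 1 = 0%R.
Proof. by apply: (addrI (f 1)); rewrite -fM mulg1 addr0. Qed.

Lemma amorphV x : f x^-1 = (- f x)%R.
Proof. by apply/eqP; rewrite -addr_eq0 -fM mulVg amorph1. Qed.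

Lemma amorphX x n : f (x ^+ n) = (f x *+ n)%R.
Proof. by elim: n => [|n IHn]; rewrite ?amorph1 // expgS fM IHn mulrS. Qed.

Lemma amorphZ x n : f (expgz x n) = (f x *~ n)%R.
Proof. by case: n => n /=; rewrite ?amorphV amorphX. Qed.
End AdditiveMorphism.

Lemma pig_eq1 (G : groupType) (N : nsgroup G) x : (pig N x = 1) <-> (x \in N).
Proof.
apply: (iff_trans (iff_sym _)); last first.
  by rewrite -(gpredV _ x) -[x^-1]mulg1; exact: pigP.
by [].
Qed.

Lemma pig_sect_eq1 (G : groupType) (H N : nsgroup G) (x : subg_of H) :
  (pig (sectns H N) x = 1) <-> (subg_val x \in N).
Proof. exact: pig_eq1. Qed.

Lemma subg_valX (G : groupType) (H : nsgroup G) n :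
  {morph (@subg_val G H) : x / x ^+ n}.
Proof. by move=> x; exact: (homX (val : subg_of H -> G)). Qed.

Lemma subg_valV (G : groupType) (H : nsgroup G) :
  {morph (@subg_val G H) : x / x^-1}.
Proof. by move=> x; exact: (homV (val : subg_of H -> G)). Qed.

Section KerQ.
Variable G : groupType.
Implicit Type N : nsgroup G.

Lemma comm_mem N x g : x \in N -> [~ x, g] \in comm N.
Proof. by move=> Nx; apply/asboolP => H; apply; exists x, g. Qed.

Lemma comm_sub N : {subset comm N <= N}.
Proof.
move=> x /asboolP; apply=> _ [n [g [Nn ->]]].
by rewrite commgEl gpredM ?gpredV // ns_conj.
Qed.

Lemma sect_comm_abelian N : abelian_group (sect N (comm N)).
Proof.
move=> a b; rewrite -(pigK a) -(pigK b); set x := repr a; set y := repr b.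
rewrite -!pigM; apply/pigP; rewrite -[_ \in _]/(subg_val ((x * y)^-1 * (y * x)) \in comm N).
have -> : subg_val ((x * y)^-1 * (y * x)) = [~ subg_val y, subg_val x].
  rewrite -[LHS]/((subg_val x * subg_val y)^-1 * (subg_val y * subg_val x)).
  by rewrite commgEl conjgE invgM !mulgA.
by apply: comm_mem; exact: subg_valP.
Qed.

Lemma kerQ_sub N : {subset kerQ N <= N}.
Proof. by move=> _ /asboolP[y [<- _]]; exact: subg_valP. Qed.

Lemma kerQ_isolated N x n : x \in N -> (0 < n)%N -> x ^+ n \in kerQ N -> x \in kerQ N.
Proof.
move=> Nx n0 /asboolP[y [yx y0]]; apply/asboolP; exists (Subg Nx); split=> //.
have : toQ (Subg Nx ^+ n) = 0%R.
  rewrite -y0; congr toQ; apply: val_inj; rewrite /= yx.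
  exact: subg_valX.
rewrite (amorphX (@toQM _ N)) -scaler_nat => /eqP; rewrite scaler_eq0.
by rewrite pnatr_eq0 -leqn0 leqNgt n0 => /eqP.
Qed.

(** Together with [kerQ_isolated], this describes [kerQ N] as the isolator of [comm N] in [N]. *)
Lemma kerQ_torsion N x : x \in kerQ N -> exists n, (0 < n)%N /\ x ^+ n \in comm N.
Proof.
move=> /asboolP[y [<- /(tens_eq0 (@sect_comm_abelian N))[n [n0 yn]]]].
exists n; split=> //; rewrite -homX in yn.
by move/pig_sect_eq1: yn; rewrite subg_valX.
Qed.

Lemma lcsQ_antitone i j : (i <= j)%N -> {subset lcsQ G j <= lcsQ G i}.
Proof.
move=> /subnK <-; elim: (j - i)%N => // n IHn x.
by rewrite addSn => /kerQ_sub /IHn.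
Qed.

(** If the series kept dropping on [H], there would be elements [a m] of [H] in the term [e m] but
    not in the next one, with [e] increasing. A dependence in the section yields a product of powers
    of the [a i], [k <= i], some power of which lies in [N]. Stability on [N] and isolation put this
    product in the term [e k + 1], which contains all factors after the first; hence it contains
    [a k], a contradiction. *)
Lemma lcsQ_section_step (H N : nsgroup G) b :
  abelian_group (sect H N) -> finite_dim (tensorQ (sect H N)) ->
  (forall i, (b <= i)%N -> forall x, x \in lcsQ G i -> x \in N -> x \in lcsQ G i.+1) ->
  exists b', forall i, (b' <= i)%N ->
    forall x, x \in lcsQ G i -> x \in H -> x \in lcsQ G i.+1.
Proof.
move=> cHN fdHN bN; apply: contrapT => nb.
have nbE c : exists p : nat * subg_of H, [/\ (c <= p.1)%N, subg_val p.2 \in lcsQ G p.1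
    & subg_val p.2 \notin lcsQ G p.1.+1].
  apply: contrapT => nc; apply: nb; exists c => i ci x xi Hx.
  by apply/negPn/negP => xi1; apply: nc; exists (i, Subg Hx).
have [p pP] := choice nbE.
(* Each counterexample is sought beyond the index of the previous one, so [e] is strictly
   increasing. *)
pose q := fix q m := if m is m'.+1 then p (q m').1.+1 else p b.
pose e m := (q m).1; pose a m := (q m).2.
have be m : (b <= e m)%N.
  elim: m => [|m IHm]; rewrite /e /=; first by case: (pP b).
  by case: (pP (q m).1.+1) => + _ _; apply: leq_trans; exact: ltnW.
have ae m : subg_val (a m) \in lcsQ G (e m).
  by case: m => [|m]; rewrite /a /e /=; [case: (pP b)|case: (pP (q m).1.+1)].
have nae m : subg_val (a m) \notin lcsQ G (e m).+1.
  by case: m => [|m]; rewrite /a /e /=; [case: (pP b)|case: (pP (q m).1.+1)].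
have e_lt m n : (m < n)%N -> (e m < e n)%N.
  elim: n => // n IHn; rewrite ltnS leq_eqVlt => mn.
  have en : (e n < e n.+1)%N by rewrite /e /=; case: (pP (q n).1.+1).
  by case/predU1P: mn => [->//|/IHn]; move/ltn_trans; apply.
have [d /(_ (fun m => tens (pig (sectns H N) (a m))))] := integral_dependence fdHN.
move=> [k [n [kd nk dep]]].
have tauM : {morph (fun y : subg_of H => tens (pig (sectns H N) y)) :
    x y / x * y >-> (x + y)%R} by move=> x y; rewrite pigM tensM.
pose y := \prod_(k <= i < d) expgz (a i) (n i).
have y0 : tens (pig (sectns H N) y) = 0%R.
  rewrite (big_morph _ tauM (amorph1 tauM)) -[RHS]dep; apply: eq_bigr => i _.
  exact: (amorphZ tauM).
have valZ (z : subg_of H) m : subg_val (expgz z m) = expgz (subg_val z) m.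
  by case: m => m /=; rewrite ?subg_valV subg_valX.
have memZ (S : nsgroup G) z m : z \in S -> expgz z m \in S.
  by case: m => m /= Sz; rewrite ?gpredXn // gpredXNn.
have valprod m : subg_val (\prod_(m <= i < d) expgz (a i) (n i)) =
    \prod_(m <= i < d) expgz (subg_val (a i)) (n i).
  apply: etrans (hom_prod (val : subg_of H -> G) _ _ _) _.
  by apply: eq_bigr => i _; exact: valZ.
have prod_mem m : \prod_(m <= i < d) expgz (subg_val (a i)) (n i) \in lcsQ G (e m).
  rewrite big_seq; apply: gpred_prod => i; rewrite mem_index_iota => /andP[mi _].
  apply: memZ; apply: (lcsQ_antitone _ (ae i)).
  by move: mi; rewrite leq_eqVlt => /predU1P[->//|/e_lt/ltnW].
have [m [m0 ym]] := tens_eq0 cHN y0.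
have yin : subg_val y \in lcsQ G (e k).+1.
  have yk : subg_val y \in lcsQ G (e k) by rewrite valprod.
  apply: (kerQ_isolated yk m0); apply: bN (be k) _ _ _; first exact: gpredXn.
  rewrite -homX in ym; by move/pig_sect_eq1: ym; rewrite subg_valX.
rewrite valprod big_ltn // gpredMr in yin; last first.
  by apply: (lcsQ_antitone _ (prod_mem k.+1)); exact: e_lt.
move/negP: (nae k); apply; case: (n k) nk yin => [[//|r]|r] _.
  by apply: kerQ_isolated => //; exact: ae.
rewrite -[expgz _ _]/(_ ^- r.+1) gpredV.
by apply: kerQ_isolated => //; exact: ae.
Qed.

(** Stability is carried up the chain from [U s], which is trivial, to [U 1], which is all of [G];
    [j] counts the steps from the bottom. *)
Lemma finite_rank_Qprenilpotent (s : nat) (U : nat -> nsgroup G) :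
  (1 <= s)%N -> (forall x, x \in U 1%N) -> (forall x, x \in U s -> x = 1) ->
  (forall i, (1 <= i < s)%N -> abelian_group (sect (U i) (U i.+1))) ->
  (forall i, (1 <= i < s)%N -> finite_dim (tensorQ (sect (U i) (U i.+1)))) ->
  Qprenilpotent G.
Proof.
move=> s1 U1 Us Uab Ufd.
have step j : (j < s)%N -> exists b, forall i, (b <= i)%N ->
    forall x, x \in lcsQ G i -> x \in U (s - j)%N -> x \in lcsQ G i.+1.
  elim: j => [|j IHj] js.
    by exists 0%N => i _ x _; rewrite subn0 => /Us ->; exact: gpred1.
  have [b bP] := IHj (ltnW js).
  have sj : ((s - j.+1).+1 = s - j)%N by rewrite subnSK // ltnW.
  have sj1 : (1 <= s - j.+1 < s)%N by rewrite subn_gt0 js ltn_subrL.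
  by apply: (@lcsQ_section_step _ (U (s - j)%N) b); rewrite -?sj; auto; rewrite sj.
have [|b bP] := step s.-1; first by rewrite prednK.
exists b => i bi x; apply/idP/idP => [xi|/kerQ_sub//].
by apply: bP => //; rewrite -subn1 subKn.
Qed.
End KerQ.

(** * Isolators in nilpotent groups *)

Section Gen.
Variable G : groupType.

Lemma gen_ind (S : set G) (P : G -> Prop) : P 1 ->
  (forall x y, P x -> P y -> P (x / y)) -> (forall s, S s -> P s) ->
  forall x, x \in gen S -> P x.
Proof.
move=> P1 PF PS x /asboolP Sx.
pose Q : {pred G} := fun y => `[< P y >].
have Qc : group_closed Q.
  split=> [|y z /asboolP Py /asboolP Pz]; apply/asboolP => //; exact: PF.
pose mM := monoid.isMulClosed.Build G Q (group_closedM Qc).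
pose m1 := monoid.isMul1Closed.Build G Q Qc.1.
pose mV := monoid.isInvClosed.Build G Q (group_closedV Qc).
pose K : groupClosed G := HB.pack Q mM m1 mV.
by have /asboolP := Sx K (fun y Sy => asboolT (PS y Sy)).
Qed.

Lemma gen_mem (S : set G) x : S x -> x \in gen S.
Proof. by move=> Sx; apply/asboolP => H; apply. Qed.

Lemma gen_closed (S : set G) : group_closed (gen S).
Proof.
split=> [|x y /asboolP Hx /asboolP Hy]; apply/asboolP => H sH.
  exact: gpred1.
by apply: gpredF; [exact: Hx | exact: Hy].
Qed.
End Gen.

Section GeneratedSubgroup.
Variables (G : groupType) (S : set G).

Record gen_of := Gen { gen_val :> G; gen_valP : gen_val \in gen S }.
HB.instance Definition _ := [isSub of gen_of for gen_val].
HB.instance Definition _ := [Choice of gen_of by <:].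
HB.instance Definition _ :=
  SubChoice_isSubGroup.Build G (gen S) gen_of (gen_closed S).
End GeneratedSubgroup.

(** Generation is needed inside the subgroup, because [isolator_generated] concerns generators of
    the whole group. *)
Lemma gen_of_generated (G : groupType) (S : set G) (x : gen_of S) :
  x \in gen [set y : gen_of S | S (gen_val y)].
Proof.
case: x => x Sx.
(* With the membership proof existentially quantified, the induction acts on the element alone. *)
suff [Sx' xP] : exists h : x \in gen S, Gen h \in gen [set y : gen_of S | S (gen_val y)].
  by rewrite (eq_irrelevance Sx Sx').
elim/gen_ind : x / Sx => [|x y [Sx xP] [Sy yP]|x Sx].
- exists (gen_closed S).1; rewrite (_ : Gen _ = 1); last exact: val_inj.
  exact: (gen_closed _).1.
- exists ((gen_closed S).2 x y Sx Sy).
  rewrite (_ : Gen _ = Gen Sx / Gen Sy); last exact: val_inj.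
  exact: ((gen_closed _).2 _ _ xP yP).
- by exists (gen_mem Sx); exact: gen_mem.
Qed.

Section LowerCentral.
Implicit Types G H : groupType.

Lemma comm_ind G (N : nsgroup G) (P : G -> Prop) : P 1 ->
  (forall x y, P x -> P y -> P (x / y)) ->
  (forall n g, n \in N -> P [~ n, g]) -> forall x, x \in comm N -> P x.
Proof. by move=> P1 PF PR; apply: gen_ind => // _ [n [g [Nn ->]]]; exact: PR. Qed.

Lemma lcs_hom G H (f : {multiplicative G -> H}) i x :
  x \in lcs G i -> f x \in lcs H i.
Proof.
elim: i x => // i IHi; apply: comm_ind => [|x y fx fy|n g /IHi fn].
- by rewrite hom1 gpred1.
- by rewrite gmulfM homV gpredF.
- by rewrite homR; exact: comm_mem.
Qed.

Lemma lcs_surj G H (f : {multiplicative G -> H}) i y :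
  (forall y, exists x, f x = y) -> y \in lcs H i -> exists2 x, x \in lcs G i & f x = y.
Proof.
move=> fsurj; elim: i y => [y _|i IHi]; first by have [x] := fsurj y; exists x.
apply: comm_ind => [|_ _ [x xi <-] [y yi <-]|_ g /IHi[n ni <-]].
- by exists 1; rewrite ?hom1 ?gpred1.
- by exists (x / y); rewrite ?gmulfM ?homV ?gpredF.
- by have [x <-] := fsurj g; exists [~ n, x]; rewrite ?homR //; exact: comm_mem.
Qed.

Definition nilclass G c : Prop := forall x, x \in lcs G c -> x = 1.

Lemma nilclass_inj G H (f : {multiplicative G -> H}) c :
  injective f -> nilclass H c -> nilclass G c.
Proof. by move=> finj Hc x /(lcs_hom f)/Hc; rewrite -(hom1 f) => /finj. Qed.

Lemma nilclass_leq G c d : (c <= d)%N -> nilclass G c -> nilclass G d.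
Proof.
move=> /subnK <- Gc; elim: (d - c)%N => // n IHn x.
by rewrite addSn => /comm_sub; exact: IHn.
Qed.

Lemma nilclass_prod G H c : nilclass G c -> nilclass H c -> nilclass (G * H)%type c.
Proof.
move=> Gc Hc [x y] xy.
have m1 := isMultiplicative.Build (G * H)%type G fst (fun _ _ => erefl).
have m2 := isMultiplicative.Build (G * H)%type H snd (fun _ _ => erefl).
pose p1 : {multiplicative (G * H)%type -> G} := HB.pack (@fst G H) m1.
pose p2 : {multiplicative (G * H)%type -> H} := HB.pack (@snd G H) m2.
by rewrite (Gc x (lcs_hom p1 xy)) (Hc y (lcs_hom p2 xy)).
Qed.

Lemma nilclass_central_extension G H (f : {multiplicative G -> H}) c :
  (forall z g, f z = 1 -> commute z g) -> nilclass H c -> nilclass G c.+1.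
Proof.
move=> fcentral Hc; apply: comm_ind => [//|x y -> ->|z g zc]; first by rewrite invg1 mulg1.
by apply/eqP/commgP; apply: fcentral; apply: Hc; exact: lcs_hom.
Qed.
End LowerCentral.

Section CentralCommutators.
Variable G : groupType.
Implicit Types x y z : G.

Lemma commXg_central y x n : commute [~ y, x] y -> [~ y ^+ n, x] = [~ y, x] ^+ n.
Proof.
move=> yx; rewrite commgEl conjXg.
have -> : y ^ x = y * [~ y, x] by rewrite commgEl mulVKg.
by rewrite expgMn ?mulKg //; exact: commute_sym.
Qed.

Lemma commgX_central y x n : commute [~ y, x] x -> [~ y, x ^+ n] = [~ y, x] ^+ n.
Proof.
move=> yx; rewrite -[LHS]invgR commXg_central; first by rewrite -(invgR x y) expVgn.
by rewrite -invgR; apply/commute_sym/commuteV/commute_sym.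
Qed.

Lemma commgM_central y x x' : (forall g, commute [~ y, x] g) ->
  [~ y, x * x'] = [~ y, x] * [~ y, x'].
Proof.
move=> yx; rewrite [LHS]commgEl conjgM.
have -> : y ^ x = y * [~ y, x] by rewrite commgEl mulVKg.
rewrite conjMg mulgA -commgEl [RHS]yx; congr (_ * _).
by rewrite conjgE yx mulKg.
Qed.

Lemma commgV_central y x : (forall g, commute [~ y, x] g) ->
  [~ y, x^-1] = [~ y, x]^-1.
Proof. by move=> yx; apply/esym/mulg1_eq; rewrite -commgM_central // mulgV commg1. Qed.

Lemma commMg_centralr h u x : (forall g, commute u g) -> [~ h * u, x] = [~ h, x].
Proof.
move=> uC; have ux : u ^ x = u by rewrite conjgE uC mulKg.
by rewrite !commgEl conjMg ux invgM -mulgA (mulgA h^-1) -uC mulKg.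
Qed.
End CentralCommutators.

Section Isolator.
Variables (G : groupType) (X H : set G) (c : nat).
Hypothesis Xgen : forall x, x \in gen X.
Hypotheses (H1 : H 1) (HF : forall x y, H x -> H y -> H (x / y)).
Hypothesis XH : forall x, X x -> exists n, (0 < n)%N /\ H (x ^+ n).
Hypothesis Gnil : nilclass G c.

Let HM x y : H x -> H y -> H (x * y).
Proof. by move=> Hx Hy; rewrite -[y]invgK; apply: HF => //; rewrite -div1g; exact: HF. Qed.

Let HX x n : H x -> H (x ^+ n).
Proof. by move=> Hx; elim: n => // n; rewrite expgS; exact: HM. Qed.

Local Notation pi i := (pig (lcs G i)).

(** For [i = c] this becomes the aim of the section, [lcs G c] being trivial; it is reached by
    climbing the series. *)
Let virtual i z := exists m h, [/\ (0 < m)%N, H h & pi i (z ^+ m) = pi i h].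

Let central i z g : z \in lcs G i -> commute (pi i.+1 z) (pi i.+1 g).
Proof.
by move=> zi; apply/commgP; rewrite -homR; apply/eqP/pig_eq1; exact: comm_mem.
Qed.

Let virtualF i z w : (forall g, commute (pi i z) g) ->
  virtual i z -> virtual i w -> virtual i (z / w).
Proof.
move=> zC [m [h [m0 Hh zh]]] [n [k [n0 Hk wk]]].
exists (m * n)%N, (h ^+ n / k ^+ m); split; first by rewrite muln_gt0 m0.
  by apply: HF; exact: HX.
rewrite homX !gmulfM !homV !homX expgMn ?expVgn; last exact: zC.
by rewrite /= -zh -wk !homX -!expgnA [(n * m)%N]mulnC.
Qed.

Let centralQ i z : z \in lcs G i -> forall g, commute (pi i.+1 z) g.
Proof. by move=> zi g; rewrite -(pigK g); exact: central. Qed.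

(* Modulo [lcs G i.+2] the commutator is bilinear on [lcs G i] and [G], so a
   power of [~ y, x] lies in [H] once powers of [y] and of the generators do. *)
Let virtual_lcs i z : z \in lcs G i -> virtual i.+1 z.
Proof.
elim: i z => [z _|i IHi].
  elim/gen_ind : z / (Xgen z) => [|x y|x /XH[n [n0 Hx]]].
  - by exists 1%N, 1.
  - by apply: virtualF; exact: centralQ.
  - by exists n, (x ^+ n).
suff Q z : z \in comm (lcs G i) -> z \in lcs G i.+1 /\ virtual i.+2 z.
  by move=> z /Q[].
move=> zc; elim/comm_ind : z / zc => [|x y [xi vx] [yi vy]|y x yi].
- by split; [exact: gpred1 | exists 1%N, 1].
- by split; [exact: gpredF | apply: virtualF => //; exact: centralQ].
split; first exact: comm_mem.
have yxC x' : forall g, commute (pi i.+2 [~ y, x']) g.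
  by apply: centralQ; exact: comm_mem.
elim/gen_ind : x / (Xgen x) => [|x x' vx vx'|x /XH[n [n0 Hx]]].
- by exists 1%N, 1; rewrite commg1.
- have [m [h [m0 Hh xh]]] := virtualF (yxC x) vx vx'.
  exists m, h; split=> //; rewrite -xh !homX /=; congr (_ ^+ _).
  have yxC' x0 g : commute [~ pi i.+2 y, pi i.+2 x0] g by rewrite -homR; exact: yxC.
  have -> : pi i.+2 [~ y, x / x'] = [~ pi i.+2 y, pi i.+2 x / pi i.+2 x'].
    by rewrite [LHS]homR gmulfM homV.
  rewrite commgM_central ?commgV_central //; try exact: yxC'.
  by rewrite [RHS]gmulfM homV !homR.
- have [r [h [r0 Hh yh]]] := IHi y yi.
  exists (r * n)%N, [~ h, x ^+ n]; split; first by rewrite muln_gt0 r0.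
    rewrite commgEl conjgE; apply: HM; first by rewrite -div1g; exact: HF.
    apply: HM; last exact: HM.
    by rewrite -div1g; exact: HF.
  (* [y ^+ r] and [h] differ by an element of [lcs G i.+1], which is central modulo [lcs G i.+2], so
     their commutators with [x ^+ n] agree there. *)
  have /pigP yhi := esym yh.
  have <- : pi i.+2 [~ y ^+ r, x ^+ n] = pi i.+2 [~ h, x ^+ n].
    rewrite -(mulVKg h (y ^+ r)); set u := _ * y ^+ r in yhi *.
    rewrite !homR gmulfM commMg_centralr //; exact: centralQ.
  rewrite homX homR !(homX, homR) commXg_central; last first.
    rewrite -!homX -homR; exact: yxC.
  rewrite commgX_central; last by rewrite -homR; exact: yxC.
  by rewrite -expgnA mulnC.
Qed.

(** If [z ^+ n] is [h] modulo [lcs G i], then [h^-1 * z ^+ n] has a power in [H] modulo the next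
    term, and it is central there, so it splits off when powers are taken. *)
Let virtual_all i z : virtual i z.
Proof.
elim: i => [|i [n [h [n0 Hh /esym/pigP zh]]]].
  by exists 1%N, 1; split=> //; apply/pigP.
have [m [k [m0 Hk zk]]] := virtual_lcs zh.
exists (n * m)%N, (h ^+ m * k); split; first by rewrite muln_gt0 n0.
  by apply: HM => //; exact: HX.
rewrite expgnA -(mulVKg h (z ^+ n)) gmulfM /= -zk !homX gmulfM expgMn //.
by apply/commute_sym; exact: centralQ.
Qed.

Lemma isolator_generated z : exists n, (0 < n)%N /\ H (z ^+ n).
Proof.
have [n [h [n0 Hh /esym/pigP/Gnil zh]]] := virtual_all c z.
by exists n; split=> //; rewrite -(mulVKg h (z ^+ n)) zh mulg1.
Qed.
End Isolator.

(** [isolator_generated] applies inside the subgroup generated by [a] and [b]. Hence the isolator of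
    a subgroup of a nilpotent group is a subgroup. *)
Lemma isolatorM (G : groupType) (H : set G) c (a b : G) m n : nilclass G c ->
  H 1 -> (forall x y, H x -> H y -> H (x / y)) ->
  (0 < m)%N -> H (a ^+ m) -> (0 < n)%N -> H (b ^+ n) ->
  exists k, (0 < k)%N /\ H ((a * b) ^+ k).
Proof.
move=> Gc H1 HF m0 Ha n0 Hb.
pose X : set G := [set x | x = a \/ x = b].
have valX k (z : gen_of X) : gen_val (z ^+ k) = gen_val z ^+ k.
  exact: (homX (val : gen_of X -> G)).
have Xa : X a by left.
have Xb : X b by right.
have [|||k [k0 Hk]] := @isolator_generated (gen_of X) [set y | X (gen_val y)]
    [set y | H (gen_val y)] c (@gen_of_generated _ _) H1 _ _ _
    (Gen (gen_mem Xa) * Gen (gen_mem Xb)).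
- by move=> x y Hx Hy; exact: HF.
- by move=> x [] xE; [exists m|exists n]; rewrite /= valX xE.
- exact: (@nilclass_inj _ _ (val : gen_of X -> G) c val_inj).
- by exists k; split=> //; move: Hk; rewrite /= valX.
Qed.

(** * Uniquely divisible nilpotent groups *)

Lemma inj_surj_bijective (T U : Type) (f : T -> U) :
  injective f -> (forall y, exists x, f x = y) -> bijective f.
Proof. by move=> finj /choice[g gK]; exists g => // x; apply: finj; rewrite gK. Qed.

Section UniqueDivisibility.
Variable M : groupType.

Lemma unique_divisibility :
  (forall n (x y : M), (0 < n)%N -> x ^+ n = y ^+ n -> x = y) ->
  (forall n (x : M), (0 < n)%N -> exists y, y ^+ n = x) -> uniquely_divisible M.
Proof.
move=> Minj Msurj n n0; apply: inj_surj_bijective => [x y|y]; first exact: Minj.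
exact: Msurj.
Qed.

Hypothesis Mud : uniquely_divisible M.

Lemma ud_inj n (x y : M) : (0 < n)%N -> x ^+ n = y ^+ n -> x = y.
Proof. by move=> /Mud/bij_inj; apply. Qed.

Lemma ud_eq1 n (x : M) : (0 < n)%N -> x ^+ n = 1 -> x = 1.
Proof. by move=> n0 xn; apply: (ud_inj n0); rewrite expg1n. Qed.

Lemma ud_root n (x : M) : (0 < n)%N -> exists y, y ^+ n = x.
Proof. by move=> /Mud[g _ gK]; exists (g x). Qed.

(** [x ^ g] and [x] have the same [n]-th power, and roots are unique. *)
Lemma ud_commuteX n (x g : M) : (0 < n)%N -> commute (x ^+ n) g -> commute x g.
Proof.
move=> n0 xg; apply/commgP; rewrite -conjg_fix; apply/eqP; apply: (ud_inj n0).
by rewrite -conjXg; apply/eqP; rewrite conjg_fix; apply/commgP.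
Qed.
End UniqueDivisibility.

Section Center.
Variable G : groupType.

Definition center_pred : {pred G} := fun x => `[< forall g, commute x g >].

Lemma center_closed : group_closed center_pred.
Proof.
split=> [|x y /asboolP xC /asboolP yC]; apply/asboolP => g.
  exact/commute_sym/commute1.
by apply/commute_sym/commuteM; [|apply: commuteV]; exact: commute_sym.
Qed.

Lemma center_conj x g : x \in center_pred -> x ^ g \in center_pred.
Proof. by move=> xC; move/asboolP: (xC) => xg; rewrite conjgE xg mulKg. Qed.

Definition center : nsgroup G := NSGroup center_closed center_conj.

Lemma centerP x : reflect (forall g, commute x g) (x \in center).
Proof. exact: asboolP. Qed.
End Center.

(** A root found in [N] is lifted to [E] and corrected by a root in the central kernel; uniqueness
    is reduced to the kernel in the same way. *)
Lemma ud_central_extension (E N : groupType) (p : {multiplicative E -> N}) :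
  (forall y, exists x, p x = y) -> (forall z g, p z = 1 -> commute z g) ->
  (forall n z, (0 < n)%N -> p z = 1 -> z ^+ n = 1 -> z = 1) ->
  (forall n z, (0 < n)%N -> p z = 1 -> exists w, p w = 1 /\ w ^+ n = z) ->
  uniquely_divisible N -> uniquely_divisible E.
Proof.
move=> psurj pC pinj proot Nud; apply: unique_divisibility => [n x y|n x] n0.
  move=> xy; have pz : p (y^-1 * x) = 1.
    rewrite gmulfM homV; apply: (mulgI (p y)); rewrite mulVKg mulg1.
    by apply: (ud_inj Nud n0); rewrite -!homX xy.
  rewrite -(mulVKg y x) in xy *; rewrite expgMn in xy; last exact/commute_sym/pC.
  rewrite (pinj _ _ n0 pz) ?mulg1 //; apply: (mulgI (y ^+ n)).
  by rewrite xy mulg1.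
have [y yx] := ud_root Nud (p x) n0; have [e ey] := psurj y.
have [|w [pw wn]] := proot n ((e ^+ n)^-1 * x) n0.
  by rewrite gmulfM homV homX ey yx mulVg.
exists (e * w); rewrite expgMn ?wn ?mulVKg //; exact/commute_sym/pC.
Qed.

Section QuotientByCenter.
Variable M : groupType.
Hypothesis Mud : uniquely_divisible M.

Lemma ud_center : uniquely_divisible (subg_of (center M)).
Proof.
apply: unique_divisibility => [n x y|n x] n0.
  move=> /(congr1 (@subg_val _ _)); rewrite !subg_valX => xy.
  by apply: val_inj; exact: (ud_inj Mud n0).
have [y yx] := ud_root Mud (subg_val x) n0.
have yC : y \in center M.
  apply/centerP => g; apply: (ud_commuteX Mud n0); rewrite yx.
  by move/centerP: (subg_valP x).
by exists (Subg yC); apply: val_inj; rewrite /= subg_valX.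
Qed.

(** A root of a central element is central. If [x ^+ n] and [y ^+ n] agree modulo the center, the
    root [w] of their quotient is therefore central, and [y = x * w]. *)
Lemma ud_quot_center : uniquely_divisible (quotg (center M)).
Proof.
apply: unique_divisibility => [n a b|n a] n0; last first.
  have [y yx] := ud_root Mud (repr a) n0.
  by exists (pig _ y); rewrite -(homX (pig (center M))) /= yx pigK.
rewrite -(pigK a) -(pigK b) -!(homX (pig (center M))) => /pigP.
set x := repr a; set y := repr b => xyC.
have [w wn] := ud_root Mud ((x ^+ n)^-1 * y ^+ n) n0.
have wC : w \in center M.
  apply/centerP => g; apply: (ud_commuteX Mud n0); rewrite wn.
  by move/centerP: xyC.
suff -> : y = x * w.
  by apply/pigP; rewrite mulKg.
apply: (ud_inj Mud n0); rewrite expgMn ?wn ?mulVKg //.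
by apply/commute_sym; move/centerP: wC.
Qed.

Lemma nilclass_quot_center c : nilclass M c.+1 -> nilclass (quotg (center M)) c.
Proof.
move=> Mc a /(@lcs_surj _ _ (pig (center M)))[b|x xc <-].
  by exists (repr b); exact: pigK.
apply/pig_eq1/centerP => g; apply/commgP/eqP/Mc; exact: comm_mem.
Qed.
End QuotientByCenter.

(** By induction through the quotient of [E] by its center, the term of index [c] lands in the
    center, so its commutators die. An element of the next term has a power generated by these, and
    [E] has no torsion. *)
Lemma lcsQ_killed (G E : groupType) (f : {multiplicative G -> E}) c :
  nilclass E c -> uniquely_divisible E -> forall x, x \in lcsQ G c -> f x = 1.
Proof.
elim: c E f => [|c IHc] E f Ec Eud x; first by move=> _; exact: Ec.
move=> /kerQ_torsion[n [n0 xn]].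
have fZ y : y \in lcsQ G c -> f y \in center E.
  have := IHc _ (pig (center E) \o f) (nilclass_quot_center Ec) (ud_quot_center Eud) y.
  by move=> /[apply] /pig_eq1.
apply: (ud_eq1 Eud n0); rewrite -homX.
elim/comm_ind: (x ^+ n) / xn => [|y z fy fz|y g /fZ/centerP yc].
- exact: hom1.
- by rewrite gmulfM homV fy fz invg1 mulg1.
- by rewrite homR; apply/eqP/commgP.
Qed.

(** * Extension of homomorphisms along a rational completion *)

Section MalcevExtension.
Variables (G M E : groupType) (phi : {multiplicative G -> M}) (sigma : {multiplicative G -> E}).
Variables (cM cE : nat).
Hypotheses (Mnil : nilclass M cM) (Enil : nilclass E cE) (Eud : uniquely_divisible E).
Hypothesis phi_sigma : forall x, phi x = 1 -> sigma x = 1.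
Hypothesis phi_root : forall y, exists n x, (0 < n)%N /\ y ^+ n = phi x.

Let graph : set (M * E) := [set p | exists x, p = (phi x, sigma x)].
(** The isolator of [graph] in [M * E] is the graph of the extension: closed under products by
    [isolatorM], total because [E] has roots and [phi] hits a power of every element, single valued
    because roots in [E] are unique. *)
Let D y e := exists n, (0 < n)%N /\ graph ((y, e) ^+ n).

Let pairX (y : M) (e : E) n : (y, e) ^+ n = (y ^+ n, e ^+ n).
Proof. by elim: n => // n IHn; rewrite !expgS IHn. Qed.

Let graph1 : graph 1.
Proof. by exists 1; rewrite !hom1. Qed.

Let graphF p q : graph p -> graph q -> graph (p / q).
Proof. by move=> [x ->] [y ->]; exists (x / y); rewrite !gmulfM !homV. Qed.

Let DM y e y' e' : D y e -> D y' e' -> D (y * y') (e * e').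
Proof.
move=> [m [m0 Dm]] [n [n0 Dn]].
apply: (@isolatorM _ graph (cM + cE) (y, e) (y', e') m n) => //.
by apply: nilclass_prod; [apply: nilclass_leq Mnil|apply: nilclass_leq Enil];
  rewrite ?leq_addr ?leq_addl.
Qed.

Let DV y e : D y e -> D y^-1 e^-1.
Proof.
move=> [n [n0 Dn]]; exists n; split=> //; have := graphF graph1 Dn.
by rewrite pairX div1g pairX !expVgn.
Qed.

Let D1 e : D 1 e -> e = 1.
Proof.
move=> [n [n0]]; rewrite pairX expg1n => -[x [/esym/phi_sigma sx en]].
by apply: (ud_eq1 Eud n0); rewrite en.
Qed.

Let Dfun y e e' : D y e -> D y e' -> e = e'.
Proof.
by move=> De /DV De'; apply: divg1_eq; apply: D1; rewrite -(mulgV y); exact: DM.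
Qed.

Let Dtotal y : exists e, D y e.
Proof.
have [n [x [n0 yx]]] := phi_root y; have [e ex] := ud_root Eud (sigma x) n0.
by exists e, n; split=> //; exists x; rewrite pairX yx ex.
Qed.

Lemma malcev_extension : exists tau : {multiplicative M -> E},
  forall x, tau (phi x) = sigma x.
Proof.
have [t tD] := choice Dtotal.
have tM : {morph t : x y / x * y}.
  by move=> x y; apply: (Dfun (tD _)); exact: DM.
pose m := isMultiplicative.Build M E t tM.
pose tau : {multiplicative M -> E} := HB.pack t m.
exists tau => x; apply: (Dfun (tD _)).
by exists 1%N; split=> //; exists x; rewrite pairX.
Qed.
End MalcevExtension.

Definition Qlocal_extension (G K : groupType) (f : {multiplicative G -> K}) : Prop :=
  forall (N : groupType) c, nilclass N c -> uniquely_divisible N ->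
  forall u : {multiplicative G -> N}, exists g : {multiplicative K -> N},
    (forall x, g (f x) = u x) /\
    forall g' : {multiplicative K -> N}, (forall x, g' (f x) = u x) -> g' =1 g.

(** An element of the kernel of [phi] has a power in the stable term, which dies in [N], so
    [malcev_extension] applies. Uniqueness holds because every [y] has a power in the image of
    [phi]. *)
Lemma malcev_Qlocal_extension (G M : groupType) (phi : {multiplicative G -> M}) c k :
  nilclass M c -> (forall i, (k <= i)%N -> {subset lcsQ G k <= lcsQ G i}) ->
  (forall x, phi x = 1 -> exists n, (0 < n)%N /\ x ^+ n \in lcsQ G k) ->
  (forall y, exists n x, (0 < n)%N /\ y ^+ n = phi x) ->
  Qlocal_extension phi.
Proof.
move=> Mc kstab phi_ker phi_root N d Nd Nud u.
have [x /phi_ker[n [n0 xn]]|g gP] :=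
    @malcev_extension _ _ _ phi u c d Mc Nd Nud _ phi_root.
  apply: (ud_eq1 Nud n0); rewrite -homX; apply: (lcsQ_killed u Nd Nud).
  (* The term that dies is indexed by the class [d] of [N], which may lie on either side of [k]. *)
  have [kd|/ltnW dk] := leqP k d; first exact: kstab.
  exact: lcsQ_antitone xn.
exists g; split=> // g' g'P y; have [n [x [n0 yx]]] := phi_root y.
by apply: (ud_inj Nud n0); rewrite -!homX yx g'P gP.
Qed.

(** * Chains in low degrees *)

Section Chains.
Local Open Scope ring_scope.

HB.instance Definition _ (G : groupType) n := GRing.isLinear.Build rat
  (chain G n.+1) (chain G n) *:%R (@bdry G n) (fglift_linear _).

HB.instance Definition _ (G H : groupType) (f : G -> H) n := GRing.isLinear.Build rat
  (chain G n) (chain H n) *:%R (@chain_map G H f n) (fglift_linear _).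

Lemma bdry_basis (G : groupType) n (x : 'I_n.+1 -> G) :
  @bdry G n << x >> = \sum_(i < n.+2) (-1) ^+ i *: << face i x >>.
Proof. exact: fglift1. Qed.

Lemma chain_map_basis (G H : groupType) (f : G -> H) n (x : 'I_n -> G) :
  chain_map f (<< x >> : chain G n) = << f \o x >>.
Proof. exact: fglift1. Qed.

Lemma chain_map_bdry (G H : groupType) (f : {multiplicative G -> H}) n (z : chain G n.+1) :
  chain_map f (bdry z) = bdry (chain_map f z).
Proof.
pose L : {linear chain G n.+1 -> chain H n} := @chain_map G H f n \o @bdry G n.
pose L' : {linear chain G n.+1 -> chain H n} := @bdry H n \o @chain_map G H f n.+1.
apply: (@freeg_ind_linear _ _ L L') => x /=.
rewrite chain_map_basis !bdry_basis linear_sum; apply: eq_bigr => i _.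
rewrite linearZ /= chain_map_basis; congr (_ *: << _ >>).
by apply/funext => j; rewrite /face /=; do 2?case: ifP => // _; rewrite gmulfM.
Qed.

Lemma is_bdry_lin (G : groupType) n a (u v : chain G n) :
  is_bdry u -> is_bdry v -> is_bdry (a *: u + v).
Proof. by move=> [x ->] [y ->]; exists (a *: x + y); rewrite linearP. Qed.

Lemma is_bdry0 (G : groupType) n : is_bdry (0 : chain G n).
Proof. by exists 0; rewrite linear0. Qed.

Section LowDegree.
Variable G : groupType.

Definition tup1 (x : G) : 'I_1 -> G := fun=> x.
Definition tup2 (x y : G) : 'I_2 -> G := fun i => if val i == 0%N then x else y.
Definition tup3 (x y z : G) : 'I_3 -> G :=
  fun i => if val i == 0%N then x else if val i == 1%N then y else z.

Lemma tup1E (w : 'I_1 -> G) : w = tup1 (w ord0).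
Proof. by apply/funext => i; rewrite ord1. Qed.

Lemma tup2E (w : 'I_2 -> G) : w = tup2 (w ord0) (w ord_max).
Proof.
apply/funext => -[[|[|//]] i2]; rewrite /tup2 /=; congr w; exact: val_inj.
Qed.

Lemma tup3E (w : 'I_3 -> G) : w = tup3 (w ord0) (w (inord 1)) (w ord_max).
Proof.
apply/funext => -[[|[|[|//]]] i3]; rewrite /tup3 /=; congr w; apply: val_inj => //=.
by rewrite inordK.
Qed.

(** Both faces of a one-entry tuple are the empty tuple, with opposite signs; so every 1-chain is a
    cycle. *)
Lemma bdry1 (z : chain G 1) : bdry z = 0.
Proof.
move: z; apply: (@freeg_ind_linear _ _ (@bdry G 0) \0) => x /=.
rewrite bdry_basis !big_ord_recl big_ord0 addr0 expr0 scale1r expr1 scaleN1r.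
by apply/eqP; rewrite subr_eq0; apply/eqP; congr << _ >>; apply/funext => -[].
Qed.

Lemma bdry2 x y : @bdry G 1 << tup2 x y >> =
  << tup1 y >> - << tup1 (x * y)%g >> + << tup1 x >>.
Proof.
rewrite bdry_basis !big_ord_recl big_ord0 addr0 expr0 scale1r expr1 scaleN1r.
rewrite -signr_odd /= expr0 scale1r addrA.
by congr (<< _ >> - << _ >> + << _ >>); apply/funext => -[[|//] i1].
Qed.

Lemma bdry3 x y z : @bdry G 2 << tup3 x y z >> =
  << tup2 y z >> - << tup2 (x * y)%g z >> + << tup2 x (y * z)%g >> - << tup2 x y >>.
Proof.
rewrite bdry_basis !big_ord_recl big_ord0 addr0 expr0 scale1r expr1 scaleN1r.
rewrite -signr_odd /= expr0 scale1r -[(-1) ^+ 3]signr_odd /= expr1 scaleN1r !addrA.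
by congr (<< _ >> - << _ >> + << _ >> - << _ >>);
  apply/funext => -[[|[|//]] i2].
Qed.

Variable W : lmodType rat.

Definition lift1 (h : G -> W) : chain G 1 -> W := fglift (fun w => h (w ord0)).
HB.instance Definition _ h := GRing.isLinear.Build rat
  (chain G 1) W *:%R (lift1 h) (fglift_linear _).

Definition lift2 (c : G -> G -> W) : chain G 2 -> W :=
  fglift (fun w => c (w ord0) (w ord_max)).
HB.instance Definition _ c := GRing.isLinear.Build rat
  (chain G 2) W *:%R (lift2 c) (fglift_linear _).

Lemma lift1_basis h x : lift1 h << tup1 x >> = h x. Proof. exact: fglift1. Qed.

Lemma lift2_basis c x y : lift2 c << tup2 x y >> = c x y. Proof. exact: fglift1. Qed.

Lemma chain1_ext (f g : {linear chain G 1 -> W}) :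
  (forall x, f << tup1 x >> = g << tup1 x >>) -> f =1 g.
Proof. by move=> fg; apply: freeg_ind_linear => w; rewrite (tup1E w). Qed.

Lemma chain2_ext (f g : {linear chain G 2 -> W}) :
  (forall x y, f << tup2 x y >> = g << tup2 x y >>) -> f =1 g.
Proof. by move=> fg; apply: freeg_ind_linear => w; rewrite (tup2E w). Qed.

Lemma chain3_ext (f g : {linear chain G 3 -> W}) :
  (forall x y z, f << tup3 x y z >> = g << tup3 x y z >>) -> f =1 g.
Proof. by move=> fg; apply: freeg_ind_linear => w; rewrite (tup3E w). Qed.

Lemma lift1_bdry (h : G -> W) : {morph h : x y / (x * y)%g >-> x + y} ->
  forall w, lift1 h (bdry w) = 0.
Proof.
move=> hM; apply: (@chain2_ext (lift1 h \o @bdry G 1) \0) => x y /=.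
by rewrite bdry2 linearD linearB /= !lift1_basis hM opprD addrA addrAC subrK subrr.
Qed.

Lemma cocycle1_morph (l : {linear chain G 1 -> W}) : (forall w, l (bdry w) = 0) ->
  {morph (fun x => l << tup1 x >>) : x y / (x * y)%g >-> x + y}.
Proof.
move=> l0 x y; have := l0 << tup2 x y >>.
rewrite bdry2 linearD linearB => /eqP; rewrite addrAC subr_eq0 addrC => /eqP.
by move=> ->.
Qed.

Lemma cocycle2E (l : {linear chain G 2 -> W}) : (forall w, l (bdry w) = 0) ->
  forall x y z, l << tup2 y z >> + l << tup2 x (y * z)%g >> =
    l << tup2 x y >> + l << tup2 (x * y)%g z >>.
Proof.
move=> l0 x y z; have := l0 << tup3 x y z >>.
rewrite bdry3 linearB linearD linearB => /eqP.
by rewrite subr_eq0 addrAC subr_eq => /eqP.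
Qed.

Lemma lift2_bdry (c : G -> G -> W) :
  (forall x y z, c y z + c x (y * z)%g = c x y + c (x * y)%g z) ->
  forall w, lift2 c (bdry w) = 0.
Proof.
move=> cP; apply: (@chain3_ext (lift2 c \o @bdry G 2) \0) => x y z /=.
rewrite bdry3 linearB linearD linearB /= !lift2_basis; apply/eqP.
by rewrite subr_eq0 addrAC subr_eq cP.
Qed.
End LowDegree.

Lemma chain_map_tup1 (G H : groupType) (f : G -> H) x :
  chain_map f (<< tup1 x >> : chain G 1) = << tup1 (f x) >>.
Proof. exact: chain_map_basis. Qed.

Lemma chain_map_tup2 (G H : groupType) (f : G -> H) x y :
  chain_map f (<< tup2 x y >> : chain G 2) = << tup2 (f x) (f y) >>.
Proof.
rewrite chain_map_basis; congr << _ >>; apply/funext => i /=.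
by rewrite /tup2; case: ifP.
Qed.
End Chains.

(** * Q-local maps are HQ-maps *)

Section MultiplicativeGroup.
(** An additive group in multiplicative notation, so that [rat] can be a target in
    [Qlocal_extension]. *)
Definition mult_group (V : zmodType) : Type := V.

Variable V : zmodType.
HB.instance Definition _ := Choice.copy (mult_group V) V.
HB.instance Definition _ := isGroup.Build (mult_group V)
  (@addrA V) (@add0r V) (@addr0 V) (@addNr V) (@addrN V).

Lemma mult_groupX (v : V) n : (v : mult_group V) ^+ n = (v *+ n)%R.
Proof. by elim: n => // n IHn; rewrite expgS IHn mulrS. Qed.
End MultiplicativeGroup.

Lemma nilclass_abelian (A : groupType) : abelian_group A -> nilclass A 1.
Proof.
move=> cA; apply: comm_ind => [//|x y -> ->|x y _]; first by rewrite invg1 mulg1.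
by apply/eqP/commgP; exact: cA.
Qed.

Lemma ud_mult_group (V : lmodType rat) : uniquely_divisible (mult_group V).
Proof.
apply: unique_divisibility => [n x y|n x] n0; last first.
  exists (n%:R^-1 *: (x : V))%R; rewrite mult_groupX -scaler_nat scalerA.
  by rewrite mulfV ?scale1r // pnatr_eq0 -lt0n.
rewrite !mult_groupX -!scaler_nat => /(congr1 (fun v : V => n%:R^-1 *: v)%R).
by rewrite !scalerA mulVf ?scale1r // pnatr_eq0 -lt0n.
Qed.

(** * Central extensions by the rationals *)

Section CentralExtension.
Variables (M : groupType) (c : M -> M -> rat).

Definition central_extension
  of (forall x y z, c y z + c x (y * z)%g = c x y + c (x * y)%g z)%R : Type :=
  (M * rat)%type.

Variable cP : (forall x y z, c y z + c x (y * z)%g = c x y + c (x * y)%g z)%R.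
Local Notation E := (central_extension cP).
HB.instance Definition _ := Choice.copy E (M * rat)%type.

(** With this sign, pairing each [x] with [b x] is multiplicative exactly when [b] has coboundary
    [c]. The cocycle is not normalised, so the unit is [(1, c 1 1)]. *)
Let mul (a b : E) : E := ((a.1 * b.1)%g, a.2 + b.2 - c a.1 b.1)%R.
Let one : E := (1, c 1 1).
Let inv (a : E) : E := (a.1^-1%g, c 1%g 1%g + c a.1^-1%g a.1 - a.2)%R.

Let c1l y : c 1 y = c 1 1.
Proof. by have := cP 1 1 y; rewrite !mul1g => h; lra. Qed.

Let c1r x : c x 1 = c 1 1.
Proof. by have := cP x 1 1; rewrite !mulg1 => h; lra. Qed.

Let cV x : c x x^-1 = c x^-1 x.
Proof. by have := cP x x^-1 x; rewrite mulVg mulgV c1l c1r => h; lra. Qed.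

Let mulA : associative mul.
Proof.
move=> [x r] [y s] [z t]; rewrite /mul /= mulgA; congr pair.
by have := cP x y z => h; lra.
Qed.
Let mul1 : left_id one mul.
Proof. by move=> [x r]; rewrite /mul /= mul1g c1l; congr pair; lra. Qed.
Let mulr1 : right_id one mul.
Proof. by move=> [x r]; rewrite /mul /= mulg1 c1r; congr pair; lra. Qed.
Let mulV : left_inverse one inv mul.
Proof. by move=> [x r]; rewrite /mul /inv /one /= mulVg; congr pair; lra. Qed.
Let mulrV : right_inverse one inv mul.
Proof. by move=> [x r]; rewrite /mul /inv /one /= mulgV cV; congr pair; lra. Qed.
HB.instance Definition _ := isGroup.Build E mulA mul1 mulr1 mulV mulrV.

Definition ext_proj (e : E) : M := e.1.
HB.instance Definition _ :=
  isMultiplicative.Build E M ext_proj (fun _ _ => erefl).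

Lemma ext_mulE (a b : E) : a * b = ((a.1 * b.1)%g, a.2 + b.2 - c a.1 b.1)%R :> M * rat.
Proof. by []. Qed.

Lemma ext_proj_central (z g : E) : ext_proj z = 1 -> commute z g.
Proof.
rewrite /ext_proj => z1; rewrite /commute !ext_mulE z1 mul1g mulg1 c1l c1r.
by rewrite [(z.2 + _)%R]addrC.
Qed.

(** The kernel of the projection is a copy of [rat] shifted by [c 1 1]. *)
Lemma ext_kerX (r : rat) n :
  ((1%g, c 1%g 1%g + r)%R : E) ^+ n = (1%g, c 1%g 1%g + r *+ n)%R :> M * rat.
Proof.
elim: n => [|n IHn]; first by rewrite mulr0n addr0.
rewrite expgS ext_mulE IHn /= mul1g mulrS; congr pair; lra.
Qed.

Lemma ext_kerE (z : E) : ext_proj z = 1 -> exists r, z = (1%g, c 1%g 1%g + r)%R.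
Proof.
case: z => x s; rewrite /ext_proj /= => ->; exists (s - c 1%g 1%g)%R.
by congr pair; lra.
Qed.

Lemma nilclass_central_ext d : nilclass M d -> nilclass E d.+1.
Proof.
by apply: (@nilclass_central_extension _ _ ext_proj) => z g; exact: ext_proj_central.
Qed.

Lemma ud_central_ext : uniquely_divisible M -> uniquely_divisible E.
Proof.
apply: (@ud_central_extension _ _ ext_proj) => [y|z g|n z n0|n z n0].
- by exists (y, 0%R).
- exact: ext_proj_central.
- move=> /ext_kerE[r ->]; rewrite ext_kerX => -[/eqP].
  rewrite -subr_eq0 addrC addKr -mulr_natr mulf_eq0 pnatr_eq0 [n == 0]eqn0Ngt n0 orbF.
  by move=> /eqP ->; rewrite addr0.
- move=> /ext_kerE[r ->]; exists (1%g, c 1%g 1%g + r / n%:R)%R; split=> //.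
  by rewrite ext_kerX -[(_ *+ n)%R]mulr_natr divfK // pnatr_eq0 -lt0n.
Qed.
End CentralExtension.

Section QlocalHQ.
Local Open Scope ring_scope.
Variables (G M : groupType) (phi : {multiplicative G -> M}) (c : nat).
Hypotheses (Mnil : nilclass M c) (Mud : uniquely_divisible M).
Hypothesis phi_local : Qlocal_extension phi.

Let Qnil : nilclass (mult_group rat) 1.
Proof. by apply: nilclass_abelian => x y; exact: addrC. Qed.

Let Qud : uniquely_divisible (mult_group rat) := @ud_mult_group rat^o.

Let local_ext (h : G -> rat) : {morph h : x y / (x * y)%g >-> x + y} ->
  exists g : M -> rat, {morph g : x y / (x * y)%g >-> x + y} /\ forall x, g (phi x) = h x.
Proof.
move=> hM; pose m := isMultiplicative.Build G (mult_group rat) h hM.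
pose u : {multiplicative G -> mult_group rat} := HB.pack (h : G -> mult_group rat) m.
have [g [gP _]] := phi_local Qnil Qud u.
exists g; split=> [x y|]; [exact: (@gmulfM _ _ g x y)|exact: gP].
Qed.

Let local_uniq (g : M -> rat) : {morph g : x y / (x * y)%g >-> x + y} ->
  (forall x, g (phi x) = 0) -> forall y, g y = 0.
Proof.
move=> gM g0 y; pose m := isMultiplicative.Build M (mult_group rat) g gM.
pose u : {multiplicative M -> mult_group rat} := HB.pack (g : M -> mult_group rat) m.
pose one_M := @one_fun M (mult_group rat).
have [g' [_ g'P]] := phi_local Qnil Qud (@one_fun G (mult_group rat)).
have one_M0 x : one_M (phi x) = @one_fun G (mult_group rat) x by [].
exact: etrans (g'P u g0 y) (esym (g'P one_M one_M0 y)).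
Qed.

(** A functional that detects [z] and kills boundaries is a homomorphism to [rat]. It extends to
    [M], so its value at [z] depends only on the image of [z], a boundary. *)
Lemma Qlocal_homology_inj1 : homology_inj phi 1.
Proof.
move=> z _ [w phiz]; apply: contrapT => nz.
have [l [l0 lz]] := linear_separation (@is_bdry0 G 1) (@is_bdry_lin G 1) nz.
have l0' v : l (bdry v) = 0 by apply: l0; exists v.
have [g [gM gP]] := local_ext (cocycle1_morph l0').
suff lE : l =1 lift1 (g : M -> rat^o) \o @chain_map G M phi 1.
  have /eqP := oner_neq0 rat; apply.
  by rewrite -lz lE /= phiz lift1_bdry.
apply: (@chain1_ext _ _ l (lift1 (g : M -> rat^o) \o @chain_map G M phi 1)) => x /=.
by rewrite chain_map_tup1 lift1_basis gP.
Qed.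

(** A functional killing boundaries and the image of [G] is a homomorphism from [M] that is trivial
    on [G], hence zero by uniqueness of extensions. *)
Lemma Qlocal_homology_surj1 : homology_surj phi 1.
Proof.
move=> w _; apply: contrapT => nw.
pose S : set (chain M 1) := [set v | exists z, is_bdry (v - chain_map phi z)].
have [||| l [l0 lw]] := @linear_separation _ S w.
- by exists 0; rewrite linear0 subr0; exact: is_bdry0.
- move=> a u v [x ux] [y vy]; exists (a *: x + y).
  by rewrite linearP opprD addrACA -scalerBr; exact: is_bdry_lin.
- by move=> [z wz]; apply: nw; exists z; split=> //; exact: bdry1.
have l0' v : l (bdry v) = 0.
  by apply: l0; exists 0; rewrite linear0 subr0; exists v.
have /eqP := oner_neq0 rat; apply; rewrite -lw.
apply: (@chain1_ext _ _ l \0) => x /=.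
apply: (local_uniq (cocycle1_morph l0')) => y; apply: l0.
by exists << tup1 y >>; rewrite chain_map_tup1 subrr; exact: is_bdry0.
Qed.

(** A functional killing boundaries and images of cycles is a 2-cocycle [k] on [M] whose pullback to
    [G] is a coboundary. So [phi] lifts to the central extension defined by [k], and the lift
    extends to [M]. This splits the extension, [k] is a coboundary, and the functional vanishes on
    cycles. *)
Lemma Qlocal_homology_surj2 : homology_surj phi 2.
Proof.
move=> w wZ; apply: contrapT => nw.
pose S : set (chain M 2) :=
  [set v | exists z : chain G 2, bdry z = 0 /\ is_bdry (v - chain_map phi z)].
have [||| l [l0 lw]] := @linear_separation _ S w.
- by exists 0; split; [exact: linear0 | rewrite linear0 subr0; exact: is_bdry0].
- move=> a u v [x [x0 ux]] [y [y0 vy]]; exists (a *: x + y).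
  split; first by rewrite linearP /= x0 y0 scaler0 addr0.
  by rewrite linearP opprD addrACA -scalerBr; exact: is_bdry_lin.
- by move=> [z wz]; apply: nw; exists z.
have l0' v : l (bdry v) = 0.
  by apply: l0; exists 0; split; [exact: linear0 | rewrite linear0 subr0; exists v].
have [|b bP] := @linear_factor _ _ _ (@bdry G 1) (l \o @chain_map G M phi 2).
  move=> z z0 /=; apply: l0; exists z; split=> //.
  by rewrite subrr; exact: is_bdry0.
pose k x y : rat := l << tup2 x y >>.
have kP := cocycle2E l0'.
pose E := central_extension (c := k) kP.
pose beta x : rat := b << tup1 x >>.
have betaE x y : beta (x * y)%g = beta x + beta y - k (phi x) (phi y).
  have := bP << tup2 x y >>; rewrite /= bdry2 chain_map_tup2 linearD linearB /=.
  rewrite /k /beta => <-; lra.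
pose sigma x : E := (phi x, beta x).
have sigmaM : {morph sigma : x y / (x * y)%g}.
  by move=> x y; rewrite /sigma betaE gmulfM.
pose m := isMultiplicative.Build G E sigma sigmaM.
pose u : {multiplicative G -> E} := HB.pack sigma m.
have [tau [tauP _]] :=
  phi_local (@nilclass_central_ext M k kP _ Mnil) (@ud_central_ext M k kP Mud) u.
(* The projection of [tau] and the identity both extend [phi] along [phi], so they coincide. *)
have tau1 y : (tau y).1 = y.
  have [g [_ gP]] := phi_local Mnil Mud phi.
  have -> : (tau y).1 = (@ext_proj M k kP \o tau) y by [].
  rewrite (gP (@ext_proj M k kP \o tau)) => [|x]; last by rewrite /= tauP.
  by rewrite -(gP idfun).
pose b' y : rat := (tau y).2.
have lE : l =1 lift1 (b' : M -> rat^o) \o @bdry M 1.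
  apply: (@chain2_ext _ _ l (lift1 (b' : M -> rat^o) \o @bdry M 1)) => x y /=.
  rewrite bdry2 linearD linearB /= !lift1_basis /b' gmulfM ext_mulE /= !tau1.
  by rewrite /k; lra.
have /eqP := oner_neq0 rat; apply.
by rewrite -lw lE /= wZ linear0.
Qed.

Lemma Qlocal_HQ_map : HQ_map phi.
Proof.
split; [exact: Qlocal_homology_inj1|exact: Qlocal_homology_surj1|].
exact: Qlocal_homology_surj2.
Qed.
End QlocalHQ.

(** * HQ-maps are Q-local *)

Section UniquelyDivisibleAbelian.
Variable A : groupType.
Hypotheses (cA : abelian_group A) (Aud : uniquely_divisible A).

Lemma tens_inj : injective (@tens A).
Proof.
move=> x y xy; apply: divg1_eq.
have [|n [n0 xyn]] := tens_eq0 cA (a := x / y).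
  by rewrite tensM tensV xy addrN.
exact: (ud_eq1 Aud n0).
Qed.

(** A fraction times [tens a] is [tens] of a root of a power of [a]. With [tens_inj], a uniquely
    divisible abelian group is a rational vector space. *)
Lemma tens_surj v : exists a : A, tens a = v.
Proof.
have tens_scale (q : rat) a : exists b : A, (tens b = q *: tens a)%R.
  have d0 : (0 < `|denq q|)%N by rewrite absz_gt0 denq_neq0.
  have [b bd] := ud_root Aud (expgz a (numq q)) d0; exists b.
  have dq0 : ((denq q)%:~R != 0 :> rat)%R by rewrite intr_eq0 denq_neq0.
  rewrite -[LHS]scale1r -(mulVf dq0) -scalerA -natr_denq scaler_nat.
  rewrite -(amorphX (@tensM A)) bd (amorphZ (@tensM A)) -scaler_int scalerA.
  by rewrite natr_denq mulrC divq_num_den.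
rewrite -(pivK v) -(freeg_sumE (repr v)) raddf_sum /=.
elim/big_rec: _ => [|x u _ [a <-]]; first by exists 1; rewrite tens1.
have [b bE] := tens_scale (coeff x (repr v)) x; exists (b * a).
rewrite tensM bE; congr (_ + _)%R.
by rewrite freegU_scale linearZ.
Qed.
End UniquelyDivisibleAbelian.

Section HQLocal.
Variables (G K : groupType) (f : {multiplicative G -> K}).
Hypothesis fHQ : HQ_map f.

(** By surjectivity on first homology, every 1-chain of [K] comes from [G] up to a boundary, and [h]
    kills both. *)
Lemma HQ_map_morph_eq0 (W : lmodType rat) (h : K -> W) :
  {morph h : x y / x * y >-> (x + y)%R} -> (forall x, h (f x) = 0%R) ->
  forall y, h y = 0%R.
Proof.
move=> hM hf y; have [_ + _] := fHQ => /(_ << tup1 y >> (bdry1 _)).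
move=> [z [_ [w /(canRL (subrK _)) yE]]].
rewrite -(lift1_basis h y) yE linearD /= lift1_bdry // add0r.
pose L : {linear chain G 1 -> W} := lift1 h \o @chain_map G K f 1.
rewrite -[LHS]/(L z); apply: (@chain1_ext _ _ L \0%R) => x /=.
by rewrite chain_map_tup1 lift1_basis.
Qed.

(* A class in [H^2(K, W)] that vanishes in [H^2(G, W)] vanishes, and the
   cochain killing it may be prescribed on [G]. *)
Lemma HQ_map_cochain_extends (W : lmodType rat) (k : K -> K -> W) (beta : G -> W) :
  (forall x y z, k y z + k x (y * z)%g = k x y + k (x * y)%g z)%R ->
  (forall x y, beta (x * y)%g = beta x + beta y + k (f x) (f y))%R ->
  exists gamma : K -> W,
    (forall x y, gamma (x * y)%g = gamma x + gamma y + k x y)%R /\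
    forall x, gamma (f x) = beta x.
Proof.
move=> kP betaP; have [Hinj _ Hsurj] := fHQ.
have kf z : lift2 k (chain_map f z) = (- lift1 beta (bdry z))%R.
  pose L := (lift2 k \o @chain_map G K f 2 : {linear chain G 2 -> W}).
  pose L' := (\0 \- (lift1 beta \o @bdry G 1) : {linear chain G 2 -> W})%R.
  suff E : L =1 L' by rewrite -[LHS]/(L z) E /= sub0r.
  apply: chain2_ext => x y /=.
  rewrite sub0r chain_map_tup2 lift2_basis bdry2 linearD linearB /= !lift1_basis.
  by rewrite betaP [X in (- X)%R]addrAC opprB (addrC (beta y)) addrAC subrr add0r.
(* The cochain is prescribed on boundaries through [k] and on the image of [G] through [beta]. *)
have [|a p q|w|b bP] := @linear_relation_extends (chain K 1) W
    [set p | exists (y : chain K 2) (v : chain G 1),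
      p.1 = (bdry y + chain_map f v)%R /\ p.2 = (lift1 beta v - lift2 k y)%R].
- by exists 0%R, 0%R; split; rewrite /= !linear0 ?addr0 ?subr0.
- move=> [y [v [/= -> ->]]] [y' [v' [/= -> ->]]].
  exists (a *: y + y')%R, (a *: v + v')%R.
  split; rewrite /= !linearP /= scalerDr ?scalerN ?opprD; exact: addrACA.
- move=> [y [v [/= /esym yv ->]]].
  have [|z vz] := Hinj v (bdry1 v).
    by exists (- y)%R; rewrite linearN; apply/eqP; rewrite -addr_eq0 addrC yv.
  have [|z' [z'0 [t tE]]] := Hsurj (y + chain_map f z)%R.
    by rewrite /= linearD /= -chain_map_bdry -vz.
  have yE : y = (bdry t + chain_map f z' - chain_map f z)%R.
    by rewrite -tE subrK addrK.
  rewrite yE linearB /= [lift2 k (_ + _)]linearD /= lift2_bdry // !kf.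
  rewrite add0r z'0 linear0 oppr0 sub0r opprK -vz.
  exact: subrr.
have bbdry y : b (bdry y) = (- lift2 k y)%R.
  by apply: bP; exists y, 0%R; rewrite !linear0 addr0 sub0r.
exists (fun x => b << tup1 x >>); split=> [x y|x]; last first.
  apply: bP; exists 0%R, << tup1 x >>.
  by split; rewrite /= linear0 ?add0r ?chain_map_tup1 // subr0 lift1_basis.
have := bbdry << tup2 x y >>; rewrite bdry2 lift2_basis linearD linearB /=.
move=> E; rewrite -[k x y]opprK -E [X in (_ - X)%R]addrAC opprB.
by rewrite [(b << tup1 y >> + _)%R]addrC [RHS]addrC subrK.
Qed.

(** * Lifting a homomorphism from the quotient by the center *)

Section CentralStep.
Variables (N : groupType) (Nud : uniquely_divisible N) (u : {multiplicative G -> N}).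
Local Notation Z := (subg_of (center N)).
Local Notation V := (tensorQ Z).
Local Notation pi := (pig (center N)).
Variable gbar : {multiplicative K -> quotg (center N)}.
Hypothesis gbarP : forall x, gbar (f x) = pi (u x).

Let cZ : abelian_group Z.
Proof. by move=> x y; apply: val_inj; move/centerP: (subg_valP x); apply. Qed.

Let Zud : uniquely_divisible Z := ud_center Nud.

(* [dlog] is the isomorphism of the center with a rational vector space *)
Let dlog_ex (x : N) : exists v : V, forall xZ : x \in center N, v = tens (Subg xZ).
Proof.
(* Outside the center the value 0 is a mere default. *)
have [xZ|nxZ] := pselect (x \in center N); last by exists 0%R.
by exists (tens (Subg xZ)) => xZ'; rewrite (eq_irrelevance xZ xZ').
Qed.

Let dlog x := sval (cid (dlog_ex x)).

Let dlogE x (xZ : x \in center N) : dlog x = tens (Subg xZ).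
Proof. exact: (svalP (cid (dlog_ex x))). Qed.

Let centerM x y : x \in center N -> y \in center N -> x * y \in center N.
Proof. by move=> xZ yZ; rewrite gpredM. Qed.

Let dlogM x y : x \in center N -> y \in center N -> dlog (x * y) = (dlog x + dlog y)%R.
Proof.
move=> xZ yZ; rewrite !dlogE ?gpredM // => xyZ; rewrite -tensM; congr tens.
exact: val_inj.
Qed.

Let dlog_inj x y : x \in center N -> y \in center N -> dlog x = dlog y -> x = y.
Proof.
by move=> xZ yZ; rewrite !dlogE => /(tens_inj cZ Zud)/(congr1 (@subg_val _ _)).
Qed.

Let dexp_ex (v : V) : exists x, x \in center N /\ dlog x = v.
Proof.
have [a <-] := tens_surj Zud v; exists (subg_val a).
by split=> [|]; [exact: subg_valP | rewrite (dlogE (subg_valP a)); case: a].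
Qed.

(** A set-theoretic lift of [gbar]. Below, [kz] is its factor set and [bz] compares it with [u] on
    [G]; both are central. *)
Let s x : N := repr (gbar x).

Let s_pi x : pi (s x) = gbar x. Proof. exact: pigK. Qed.

Let kz x y : N := s x * s y / s (x * y).

Let center_pi x y : pi x = pi y -> x / y \in center N.
Proof.
by move=> xy; apply/pig_eq1; rewrite gmulfM homV /= xy mulgV.
Qed.

Let kzZ x y : kz x y \in center N.
Proof. by apply: center_pi; rewrite gmulfM /= !s_pi gmulfM. Qed.

Let kzE x y : s x * s y = kz x y * s (x * y). Proof. by rewrite /kz mulgVK. Qed.

Let kz_cocycle x y z : kz y z * kz x (y * z) = kz x y * kz (x * y) z.
Proof.
apply: (mulIg (s (x * y * z))); transitivity (s x * s y * s z); last first.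
  by rewrite -(mulgA (kz x y)) -kzE mulgA -kzE.
rewrite -(mulgA (kz y z)) -(mulgA x) -kzE mulgA.
have /centerP -> := kzZ y z.
by rewrite -(mulgA (s x)) -kzE mulgA.
Qed.

Let bz x : N := u x / s (f x).

Let bzZ x : bz x \in center N.
Proof. by apply: center_pi; rewrite s_pi gbarP. Qed.

Let bzE x : u x = bz x * s (f x). Proof. by rewrite /bz mulgVK. Qed.

Let bzM x y : bz (x * y) = bz x * bz y * kz (f x) (f y).
Proof.
apply: (mulIg (s (f (x * y)))); rewrite -bzE gmulfM [f (x * y)]gmulfM.
rewrite -(mulgA (bz x * bz y)) -kzE !bzE.
rewrite (mulgA (bz x * s (f x)) (bz y)) (mulgA (bz x * bz y) (s (f x))).
congr (_ * _); rewrite -(mulgA (bz x) (s _)) -(mulgA (bz x) (bz y)).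
by have /centerP -> := bzZ y.
Qed.

(** On [G] the cochain [bz] trivialises the factor set. It extends to a cochain [gamma] doing so on
    [K], and correcting [s] by [gamma] gives a homomorphism that restricts to [u]. *)
Lemma central_step_exists : exists g : {multiplicative K -> N}, forall x, g (f x) = u x.
Proof.
have [x y z|x y|gamma [gammaM gammaf]] :=
    @HQ_map_cochain_extends V (fun x y => dlog (kz x y)) (fun x => dlog (bz x)).
- rewrite -(dlogM (kzZ y z) (kzZ x (y * z))) -(dlogM (kzZ x y) (kzZ (x * y) z)).
  by rewrite kz_cocycle.
- by rewrite bzM (dlogM (centerM (bzZ x) (bzZ y)) (kzZ _ _)) (dlogM (bzZ x) (bzZ y)).
have [e eP] := choice dexp_ex.
have eZ v : e v \in center N by case: (eP v).
have dloge v : dlog (e v) = v by case: (eP v).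
pose g x := e (gamma x) * s x.
have gM : {morph g : x y / x * y}.
  move=> x y; rewrite /g gammaM.
  have -> : e (gamma x + gamma y + dlog (kz x y))%R = e (gamma x) * e (gamma y) * kz x y.
    have exyZ := centerM (eZ (gamma x)) (eZ (gamma y)).
    apply: (dlog_inj (eZ _) (centerM exyZ (kzZ x y))).
    by rewrite (dlogM exyZ (kzZ x y)) (dlogM (eZ (gamma x)) (eZ (gamma y))) !dloge.
  rewrite -(mulgA (e (gamma x) * e (gamma y))) -kzE !mulgA; congr (_ * _).
  by rewrite -!mulgA; have /centerP -> := eZ (gamma y).
pose m := isMultiplicative.Build K N g gM.
pose gL : {multiplicative K -> N} := HB.pack g m.
exists gL => x; rewrite bzE; congr (_ * _).
by apply: (dlog_inj (eZ _) (bzZ x)); rewrite dloge gammaf.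
Qed.

(** The quotient of the two maps is central, hence a homomorphism to a rational vector space, and it
    is trivial on [G]. *)
Lemma central_step_unique (g g' : {multiplicative K -> N}) :
  (forall x, g (f x) = g' (f x)) -> (forall x, pi (g x) = pi (g' x)) -> g' =1 g.
Proof.
move=> gf gpi x; pose d y := g' y / g y.
have dZ y : d y \in center N by apply: center_pi; rewrite gpi.
have dM : {morph d : y z / y * z}.
  move=> y z; transitivity (g' y * d z / g y).
    by rewrite /d !gmulfM invgM !mulgA.
  by rewrite -(mulgA (g' y)); have /centerP -> := dZ z; rewrite mulgA.
apply: divg1_eq; apply: dlog_inj => //; rewrite -?/(d x) ?gpred1 //.
have dlog1 : dlog 1 = 0%R.
  by apply: (addrI (dlog 1)); rewrite -dlogM ?gpred1 // mulg1 addr0.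
rewrite dlog1; apply: (@HQ_map_morph_eq0 V (fun y => dlog (d y))) => [y z|y].
  by rewrite dM dlogM.
by rewrite /d gf mulgV.
Qed.
End CentralStep.

Lemma HQ_map_Qlocal : Qlocal_extension f.
Proof.
move=> N c; elim: c N => [|c IHc] N Nc Nud u.
  exists (@one_fun K N); split=> [x|g' _ y]; first by rewrite [RHS]Nc.
  exact: Nc.
have [gbar [gbarP gbar_uniq]] := IHc _ (nilclass_quot_center Nc) (ud_quot_center Nud)
  (pig (center N) \o u).
have [g gP] := central_step_exists Nud gbarP.
exists g; split=> // g' g'P; apply: central_step_unique => // x; first by rewrite gP g'P.
rewrite -[LHS]/((pig (center N) \o g) x) -[RHS]/((pig (center N) \o g') x).
by rewrite !gbar_uniq // => y /=; rewrite ?gP ?g'P.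
Qed.
End HQLocal.

(** * The Q-completion *)

Lemma finI_from_mem (I : choiceType) T (D : set I) (f : I -> set T) A :
  (exists2 i, D i & f i = A) -> finI_from D f A.
Proof. by move=> [i Di <-]; exact: finI_from1. Qed.

Lemma sup_entourage (T : choiceType) (I : Type) (Tc : I -> Uniform T) i (A : set (T * T)) :
  @entourage (Uniform.Pack (Tc i)) A -> sup_ent Tc A.
Proof.
move=> EA; exists A => //; apply: finI_from_mem.
by exists (exist (fun q : {classic I} * set (T * T) =>
  `[< @entourage (Uniform.Pack (Tc q.1)) q.2 >]) (i, A) (asboolT EA)).
Qed.

Lemma proj_entourage (I : Type) (T : I -> uniformType) i (E : set (T i * T i)) :
  entourage E -> @entourage (prod_topology T) [set xy | E (xy.1 i, xy.2 i)].
Proof.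
move=> EE.
apply: (@sup_entourage _ _ (fun i => Uniform.class (initial_topology (@proj _ T i))) i).
by exists E.
Qed.

(** Equality of tuples is a finite intersection of entourages, so every cochain is uniformly
    continuous and the two complexes coincide. *)
Lemma discrete_cohomologically_discrete (G : topGroupType) :
  nbhs (1 : G) [set 1] -> cohomologically_discrete G.
Proof.
move=> G1.
have unif n (f : cochain G n) : uniform_cochain f.
  move=> A /entourage_refl Adiag.
  pose P := prod_topology (fun _ : 'I_n => left_uniform G).
  have : @entourage P [set xy | forall i, xy.1 i = xy.2 i].
    apply: (@filter_forall _ _ (fun i xy => xy.1 i = xy.2 i) _ (@entourage_filter P)) => i.
    apply: (@proj_entourage _ (fun _ : 'I_n => left_uniform G) i
      [set xy | xy.1 = xy.2]).
    exists [set 1] => // -[x y] /= xy1.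
    by apply: (mulgI x^-1); rewrite xy1 mulVg.
  apply: (@filterS _ _ (@entourage_filter P)) => -[x y] /= xy.
  by rewrite (functional_extensionality_dep xy); exact: Adiag.
move=> m; split=> [f _ _|f fZ].
  by case: m f => [|m] f // [h [_ fh]]; exists h.
exists f; split=> //; case: m f fZ => [|m] f _ /=; first by move=> x; rewrite subrr.
exists (fun=> 0%R); split=> //; apply/funext => x; rewrite subrr /dcochain.
by rewrite big1 // => i _; rewrite mulr0.
Qed.

(** * The completion when the series stabilises *)

Section StableCompletion.
Variables (G : groupType) (T : Qtower G) (k : nat).
Hypothesis stable : forall i, (k <= i)%N -> lcsQ G i =i lcsQ G i.+1.
Local Notation L := (Qcompletion T).

Lemma qmap_eq1 i (x : G) : qmap T i (pig _ x) = 1 ->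
  exists n, (0 < n)%N /\ x ^+ n \in lcsQ G i.
Proof.
have [_ _ kerP _] := qmapP T i => /kerP[n [n0 xn]]; exists n; split=> //.
by apply/pig_eq1; rewrite homX.
Qed.

(** A power of [y] comes from [G]. Its representative there has a power in [lcsQ G i], which equals
    [lcsQ G i.+1], so [y] is torsion and hence trivial. *)
Lemma qtrans_inj i : (k <= i)%N -> injective (qtrans T i).
Proof.
move=> ki; apply: hom_inj => y y1.
have [_ ud1 _ /(_ y)[n [a [n0 yn]]]] := qmapP T i.+1.
have [_ _ ker1 _] := qmapP T i.+1.
have [|m [m0 xm]] := @qmap_eq1 i (repr a).
  by rewrite -(qtransE T) pigK -yn homX y1 expg1n.
have /ker1 a1 : exists m, (0 < m)%N /\ a ^+ m = 1.
  exists m; split=> //; rewrite -(pigK a) -(homX (pig _)).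
  by apply/pig_eq1; rewrite -stable.
by apply: (ud_eq1 ud1 n0); rewrite yn.
Qed.

(** Injectivity of the transition maps determines the coordinates above [i], compatibility those
    below. *)
Lemma coord_inj (x y : L) i : (k <= i)%N -> Defs.coord x i = Defs.coord y i -> x = y.
Proof.
move=> ki xyi; apply/invlim_ext/functional_extensionality_dep.
have up d : Defs.coord x (i + d) = Defs.coord y (i + d).
  elim: d => [|d IHd]; first by rewrite addn0.
  rewrite addnS; apply: (@qtrans_inj (i + d)); first exact: leq_trans (leq_addr _ _).
  by rewrite !coordP.
have down d j : Defs.coord x (j + d) = Defs.coord y (j + d) -> Defs.coord x j = Defs.coord y j.
  elim: d => [|d IHd]; first by rewrite addn0.
  by rewrite addnS => e; apply: IHd; rewrite -(coordP x) -(coordP y) e.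
by move=> j; apply: (down i); rewrite addnC.
Qed.

Lemma Qcompletion_discrete : nbhs (1 : L) [set 1].
Proof.
(* The basic neighbourhood fixes the coordinates of index less than [k.+1], thus including [k]. *)
apply/invlim_nbhsP; exists k.+1 => y y1.
by apply: (coord_inj (leqnn k)); exact: y1.
Qed.

Let coordk (x : L) : qgrp T k := Defs.coord x k.
HB.instance Definition _ :=
  isMultiplicative.Build L (qgrp T k) coordk (fun _ _ => erefl).

Lemma Qcompletion_nilclass : exists c, nilclass L c.
Proof.
have [[c nilc] _ _ _] := qmapP T k; exists c.
by apply: (@nilclass_inj _ _ coordk) => // x y; exact: coord_inj.
Qed.

Lemma coordX (x : L) n i : Defs.coord (x ^+ n) i = Defs.coord x i ^+ n.
Proof. by elim: n => // n IHn; rewrite !expgS -IHn. Qed.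

Lemma Qcompletion_ud : uniquely_divisible L.
Proof.
have ud i : uniquely_divisible (qgrp T i) by have [] := qmapP T i.
apply: unique_divisibility => [n x y|n x] n0.
  move=> xy; apply: (coord_inj (leqnn k)); apply: (ud_inj (ud k) n0).
  by rewrite -!coordX xy.
pose r i := sval (cid (ud_root (ud i) (Defs.coord x i) n0)).
have rn i : r i ^+ n = Defs.coord x i by exact: (svalP (cid (ud_root (ud i) (Defs.coord x i) n0))).
(* Roots are unique, so those chosen coordinate by coordinate are compatible. *)
have rP i : qtrans T i (r i.+1) = r i.
  by apply: (ud_inj (ud i) n0); rewrite -homX !rn coordP.
exists (InvLim rP); apply: (coord_inj (leqnn k)).
by rewrite coordX /= rn.
Qed.

Lemma to_Qcompletion_local : Qlocal_extension (to_Qcompletion T).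
Proof.
have [c nilc] := Qcompletion_nilclass.
apply: (@malcev_Qlocal_extension _ _ _ c k nilc) => [i|x x1|y].
- move=> /subnK <-; elim: (i - k)%N => // d IHd x xk.
  by rewrite addSn -stable ?leq_addl //; exact: IHd.
- by apply: qmap_eq1; exact: (congr1 coordk x1).
have [_ _ _ /(_ (Defs.coord y k))[n [a [n0 yn]]]] := qmapP T k.
exists n, (repr a); split=> //; apply: (coord_inj (leqnn k)).
by rewrite coordX yn /= pigK.
Qed.

(** The localization is [L] itself and the comparison map the identity: [L] is nilpotent and
    uniquely divisible, so [to_Qcompletion T] extends uniquely along every HQ-map. *)
Lemma stable_HQ_good : HQ_good T.
Proof.
have [c nilc] := Qcompletion_nilclass.
exists L, (to_Qcompletion T); split; last first.
  by exists idfun; split=> //; exists idfun.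
split.
  exact: Qlocal_HQ_map nilc Qcompletion_ud to_Qcompletion_local.
move=> K f fHQ; exact: HQ_map_Qlocal fHQ _ _ nilc Qcompletion_ud (to_Qcompletion T).
Qed.
End StableCompletion.

Local Close Scope classical_set_scope.
Local Close Scope quotient_scope.
Local Close Scope group_scope.

Theorem proposition4p7 (G : groupType) (s : nat) (U : nat -> nsgroup G)
    (s_ge1 : (1 <= s)%N)
    (U_first : forall x : G, x \in U 1)
    (U_last : forall x : G, x \in U s -> x = 1%g)
    (U_decr : forall i, (1 <= i < s)%N -> {subset U i.+1 <= U i})
    (U_abelian : forall i, (1 <= i < s)%N -> abelian_group (sect (U i) (U i.+1)))
    (U_findim : forall i, (1 <= i < s)%N ->
       finite_dim (tensorQ (sect (U i) (U i.+1)))) :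
  Qprenilpotent G /\
  (forall T : Qtower G, cohomologically_discrete (Qcompletion T)) /\
  (finitely_generated G -> forall T : Qtower G, HQ_good T).
Proof.
have GQ : Qprenilpotent G by exact: finite_rank_Qprenilpotent U_abelian U_findim.
have [k kP] := GQ; split=> //; split=> [T|_ T].
  by apply: discrete_cohomologically_discrete; exact: Qcompletion_discrete kP.
exact: stable_HQ_good kP.
Qed.
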